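(* Let $n\ge 3$. For $(\phi_1,\ldots,\phi_n)\in SU(2)^n$ let $\lambda_1=\lambda_1(\phi_1,\ldots,\phi_n)$ be the supremum of the eigenvalues of the self-adjoint operator $\phi_1+\phi_1^{-1}+\cdots+\phi_n+\phi_n^{-1}$ acting on $L^2_0(SU(2))$. Then either $\lambda_1<2n$ for almost every $(\phi_1,\ldots,\phi_n)\in SU(2)^n$, or $\lambda_1=2n$ for almost every $(\phi_1,\ldots,\phi_n)\in SU(2)^n$.
   Context: $L^2_0(SU(2))$ is the orthogonal complement of the constant functions in $L^2(SU(2))$, where $SU(2)$ carries Haar measure. An element $\phi\in SU(2)$ acts unitarily on $L^2_0(SU(2))$ through the left translation action, $(\phi f)(x)=f(\phi^{-1}x)$, and sums of group elements denote the corresponding sums of unitary operators. ''Almost every'' is with respect to the product Haar measure on $SU(2)^n$. One always has $\lambda_1\le 2n$. *)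

(* Defs.v *)
From HB Require Import structures.
From mathcomp Require Import all_boot all_order all_algebra.
From mathcomp Require Import complex.
From mathcomp Require Import all_classical all_reals all_analysis.
Set Implicit Arguments. Unset Strict Implicit. Unset Printing Implicit Defensive.
Import Order.TTheory GRing.Theory Num.Theory.
Import numFieldNormedType.Exports.
Local Open Scope classical_set_scope.
Local Open Scope ring_scope.
Local Open Scope complex_scope.

Record SU2 (R : realType) := MkSU2 {
  SU2val :> 'M[R[i]]_2;
  SU2P : (SU2val \is unitarymx) && (\det SU2val == 1) }.

HB.instance Definition _ (R : realType) := [isSub for @SU2val R].
HB.instance Definition _ (R : realType) := [Choice of SU2 R by <:].

Section SU2_group.
Variable R : realType.
Implicit Types A B : SU2 R.

Fact SU2_one_subproof :
  ((1%:M : 'M[R[i]]_2) \is unitarymx) && (\det (1%:M : 'M[R[i]]_2) == 1).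
Proof.
by rewrite det1 eqxx andbT; apply/unitarymxP; rewrite trmx1 map_mx1 mulmx1.
Qed.

Fact SU2_mul_subproof A B :
  ((A *m B : 'M[R[i]]_2) \is unitarymx) && (\det (A *m B) == 1).
Proof.
case: A B => [A /andP[uA /eqP dA]] [B /andP[uB /eqP dB]] /=.
by rewrite mul_unitarymx//= det_mulmx dA dB mul1r eqxx.
Qed.

Fact SU2_inv_subproof A :
  ((A^t* : 'M[R[i]]_2)%sesqui \is unitarymx) && (\det (A^t*)%sesqui == 1).
Proof.
case: A => [A /andP[uA /eqP dA]] /=.
by rewrite trmxC_unitary uA/= det_map_mx det_tr dA rmorph1 eqxx.
Qed.

Definition SU2_one := MkSU2 SU2_one_subproof.
Definition SU2_mul A B := MkSU2 (SU2_mul_subproof A B).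
Definition SU2_inv A := MkSU2 (SU2_inv_subproof A).

Fact SU2_mulA : associative SU2_mul.
Proof. by move=> A B D; apply: val_inj; rewrite /= mulmxA. Qed.
Fact SU2_mul1 : left_id SU2_one SU2_mul.
Proof. by move=> A; apply: val_inj; rewrite /= mul1mx. Qed.
Fact SU2_1mul : right_id SU2_one SU2_mul.
Proof. by move=> A; apply: val_inj; rewrite /= mulmx1. Qed.
Fact SU2_mulV : right_inverse SU2_one SU2_inv SU2_mul.
Proof.
by move=> A; apply: val_inj => /=; apply/unitarymxP; have /andP[] := SU2P A.
Qed.
Fact SU2_Vmul : left_inverse SU2_one SU2_inv SU2_mul.
Proof.
move=> A; apply: val_inj; apply: mulmx1C.
by have /(congr1 val) := SU2_mulV A.
Qed.

HB.instance Definition _ := isGroup.Build (SU2 R)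
  SU2_mulA SU2_mul1 SU2_1mul SU2_Vmul SU2_mulV.

HB.instance Definition _ := isPointed.Build (SU2 R) SU2_one.

(* The cast equips the entries with the usual topology of the complex plane. *)
HB.instance Definition _ := Topological.copy (SU2 R)
  (initial_topology
    (@SU2val R : SU2 R -> 'M[(R[i] : numClosedFieldType)]_2)).

HB.instance Definition _ := Measurable.copy (SU2 R)
  (g_sigma_algebraType (open : set (set (SU2 R)))).

End SU2_group.

(* A left-invariant Borel probability measure on the compact group SU(2) is its
   Haar measure. *)
Definition left_invariant (R : realType) (mu : set (SU2 R) -> \bar R) :=
  forall (g : SU2 R) (A : set (SU2 R)), measurable A ->
    mu ((fun x => (g * x)%g) @^-1` A) = mu A.

Section power_probability.
Context d (T : measurableType d) (R : realType).

Definition consp n (x : T * n.-tuple T) : n.+1.-tuple T := [tuple of x.1 :: x.2].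

Fact measurable_consp n : measurable_fun [set: T * n.-tuple T] (@consp n).
Proof. exact: measurable_cons measurable_fst measurable_snd. Qed.

HB.instance Definition _ n :=
  isMeasurableFun.Build _ _ _ _ (@consp n) (@measurable_consp n).

Fixpoint power_prob (P : probability T R) n : probability (n.-tuple T) R :=
  if n is m.+1 then distribution (P \x power_prob P m)%E (@consp m)
  else \d_[tuple].

Lemma power_probE (P : probability T R) n (A : 'I_n -> set T) : (forall i, measurable (A i)) ->
  power_prob P n [set x | forall i, A i (tnth x i)] = (\prod_(i < n) P (A i))%E.
Proof.
elim: n A => [|n IHn] A mA.
  rewrite big_ord0 /= diracE (_ : _ \in _ = true)//.
  by apply/mem_set => -[].
rewrite big_ord_recl -IHn//= /distribution /pushforward.
rewrite (_ : _ @^-1` _ = A ord0 `*`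
  [set x | forall i, A (lift ord0 i) (tnth x i)]).
  rewrite product_measure1E//.
  rewrite (_ : mkset _ = \bigcap_(i in [set: 'I_n]) ((tnth (T:=T) ^~ i) @^-1` A (lift ord0 i))).
    apply: fin_bigcap_measurable; first exact: finite_finset.
    move=> i _; rewrite -[X in measurable X]setTI.
    exact: (measurable_tnth i measurableT (mA _)).
  by apply/seteqP; split=> x /= h i; [move=> _|]; exact: h.
apply/seteqP; split=> -[a x] /=.
  move=> h; split=> [|i]; first by have := h ord0; rewrite tnth0.
  by have := h (lift ord0 i); rewrite tnthS.
move=> [h0 h] i; case: (unliftP ord0 i) => [j ->|->]; first by rewrite tnthS.
by rewrite tnth0.
Qed.

End power_probability.

Section L2.
Variables (R : realType) (mu : probability (SU2 R) R).
Implicit Types f g : SU2 R -> R[i].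

(* Elements of the L2 spaces are represented by square-integrable functions;
   equality of classes is equality almost everywhere. *)
Definition L2 f :=
  (fun x => complex.Re (f x)) \in Lfun mu 2%:E /\
  (fun x => complex.Im (f x)) \in Lfun mu 2%:E.

Definition cintegral f : R[i] :=
  Rintegral mu setT (fun x => complex.Re (f x)) +i*
  Rintegral mu setT (fun x => complex.Im (f x)).

Definition inner f g : R[i] := cintegral (fun x => f x * (g x)^*%C).

Definition L20 f := L2 f /\ forall c : R[i], inner f (cst c) = 0.

Definition ltranslate (phi : SU2 R) f : SU2 R -> R[i] :=
  fun x => f (phi^-1 * x)%g.

Definition sum_op n (phi : n.-tuple (SU2 R)) f : SU2 R -> R[i] :=
  fun x => \sum_(i < n) (ltranslate (tnth phi i) f x
                       + ltranslate (tnth phi i)^-1%g f x).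

Definition is_eigenvalue n (phi : n.-tuple (SU2 R)) (z : R[i]) :=
  exists f, [/\ L20 f, ~ (f = cst 0 %[ae mu]) &
    sum_op phi f = (fun x => z * f x) %[ae mu]].

(* The operator is self-adjoint, so that its eigenvalues are real. *)
Definition lambda1 n (phi : n.-tuple (SU2 R)) : \bar R :=
  ereal_sup [set t%:E | t in [set t : R | is_eigenvalue phi t%:C]].

End L2.

(* Main.v *)
(* Call [phi] almost invariant if mean-zero polynomials in the matrix entries
   have arbitrarily small total energy sum_i |phi_i f - f|^2 compared with
   |f|^2.  Polynomials of bounded degree form finite-dimensional invariant
   spaces on which the operator is diagonalizable, and they separate L^2
   functions, so lambda_1 = 2n if [phi] is almost invariant and lambda_1 < 2n
   otherwise.

   The set A of almost invariant tuples is Borel and stable under the moves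
   phi_j -> phi_i phi_j, i != j.  For n >= 3 there are two indices i, k != j.
   For almost every pair (phi_i, phi_k) a polynomial invariant under both is
   constant: phi_i has infinite order, so that invariance extends to its
   maximal torus, and a conjugate of the torus by phi_k then generates
   everything.  Applied to the moments of an invariant set, this shows that
   each section of A in the j-th variable has measure 0 or 1, and a Kolmogorov
   type argument gives that A itself has measure 0 or 1. *)

Require Import Defs.
From mathcomp Require Import all_boot all_order all_algebra.
From mathcomp Require Import complex.
From mathcomp Require Import all_classical all_reals all_analysis.
From mathcomp Require polyrcf.
From mathcomp Require Import measurable_realfun.
From mathcomp Require Import ring lra.
Set Implicit Arguments. Unset Strict Implicit. Unset Printing Implicit Defensive.
Import Order.TTheory GRing.Theory Num.Theory.
Import numFieldNormedType.Exports.
Local Open Scope classical_set_scope.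
Local Open Scope ring_scope.
Local Open Scope complex_scope.

(** * The group SU(2) in coordinates *)

Section coordinates.
Variable R : realType.
Implicit Types x y : SU2 R.

(** The number [lambda1] is a supremum of eigenvalues, not of the spectrum, so genuine
    eigenfunctions have to be produced; restriction to finite-dimensional invariant spaces produces
    them. On such a space the total energy of f equals 2n |f|^2 minus the quadratic form of the
    operator, so small energy means a Rayleigh quotient close to 2n. Energy is preferred to the
    quadratic form because it is nonnegative and behaves well under products: the energy of g h is
    at most twice the sum of the energies of g and h, whence the stability under the moves, at the
    cost of a constant factor only.

    Monomials in the coordinates are in general linearly dependent as functions on the group, so
    their Gram matrix is singular. Eigenvalues on the span are therefore those of a matrix pencil
    with a degenerate form, and identities between coefficient vectors hold only modulo the kernel
    of the Gram matrix, that is, modulo functions vanishing almost everywhere. *)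

Lemma conjcM (a b : R[i]) : (a * b)^*%C = a^*%C * b^*%C.
Proof. exact: rmorphM. Qed.

Lemma conjcD (a b : R[i]) : (a + b)^*%C = a^*%C + b^*%C.
Proof. exact: rmorphD. Qed.

Lemma conjcN (a : R[i]) : (- a)^*%C = - a^*%C.
Proof. exact: rmorphN. Qed.

Definition alpha x : R[i] := x ord0 ord0.
Definition beta x : R[i] := x ord0 ord_max.

Lemma sum_ord2 (V : nmodType) (F : 'I_2 -> V) :
  \sum_i F i = F ord0 + F ord_max.
Proof. by rewrite big_ord_recr/= big_ord1; congr (F _ + _); apply/val_inj. Qed.

Lemma lift20 (i : 'I_1) : lift ord0 i = ord_max :> 'I_2.
Proof. by rewrite ord1; apply/val_inj. Qed.

Lemma lift21 (i : 'I_1) : lift ord_max i = ord0 :> 'I_2.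
Proof. by rewrite ord1; apply/val_inj. Qed.

(** Unitarity and determinant 1 identify the adjugate with the conjugate transpose; the entries are
    then cofactors. *)
Lemma SU2_entries x : x ord_max ord0 = - (beta x)^*%C /\
  x ord_max ord_max = (alpha x)^*%C.
Proof.
have /andP[/unitarymxP xx /eqP dx] := SU2P x.
have xV : (x : 'M[R[i]]_2) *m (\adj x) = 1%:M by rewrite mul_mx_adj dx.
have e : \adj x = ((x : 'M[R[i]]_2)^t*)%sesqui.
  by rewrite -[LHS]mul1mx -(mulmx1C xx) -mulmxA xV mulmx1.
have co i j : ((x : 'M[R[i]]_2) i j)^*%C = cofactor x i j.
  by have /matrixP /(_ j i) := e; rewrite !mxE => ->.
rewrite /alpha /beta !co /cofactor !det_mx11 !mxE lift20 lift21 /=.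
by rewrite !addn0 addn1 expr0 expr1 mul1r mulN1r opprK.
Qed.

Lemma SU2_norm x : alpha x * (alpha x)^*%C + beta x * (beta x)^*%C = 1.
Proof.
have /andP[/unitarymxP /matrixP /(_ ord0 ord0) + _] := SU2P x.
by rewrite !mxE sum_ord2 !mxE.
Qed.

Lemma ord2P (P : 'I_2 -> Prop) : P ord0 -> P ord_max -> forall i, P i.
Proof.
move=> P0 P1; case=> [[|[|//]]] lt.
- by rewrite (_ : Ordinal lt = ord0)//; apply/val_inj.
- by rewrite (_ : Ordinal lt = ord_max)//; apply/val_inj.
Qed.

Lemma SU2_ext x y : alpha x = alpha y -> beta x = beta y -> x = y.
Proof.
move=> ab bb; apply/val_inj/matrixP => /=.
have [x1 x2] := SU2_entries x; have [y1 y2] := SU2_entries y.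
apply: ord2P; apply: ord2P => //; first by rewrite x1 y1 bb.
by rewrite x2 y2 ab.
Qed.

Lemma alphaM x y : alpha (x * y)%g = alpha x * alpha y - beta x * (beta y)^*%C.
Proof.
have [y1 y2] := SU2_entries y.
by rewrite [LHS]mxE sum_ord2 y1 mulrN.
Qed.

Lemma betaM x y : beta (x * y)%g = alpha x * beta y + beta x * (alpha y)^*%C.
Proof.
have [y1 y2] := SU2_entries y.
by rewrite [LHS]mxE sum_ord2 y2.
Qed.

Lemma alphaV x : alpha x^-1%g = (alpha x)^*%C.
Proof. by rewrite /alpha !mxE. Qed.

Lemma betaV x : beta x^-1%g = - beta x.
Proof.
by have [x1 x2] := SU2_entries x; rewrite /beta !mxE x1 rmorphN; congr (- _); exact: conjcK.
Qed.

Lemma alpha1 : alpha 1%g = 1. Proof. by rewrite /alpha !mxE. Qed.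
Lemma beta1 : beta 1%g = 0. Proof. by rewrite /beta !mxE. Qed.

Definition mxab (a b : R[i]) : 'M[R[i]]_2 := \matrix_(i, j)
  if i == ord0 then (if j == ord0 then a else b)
  else if j == ord0 then - b^*%C else a^*%C.

Lemma mxab_SU2 (a b : R[i]) : a * a^*%C + b * b^*%C = 1 ->
  (mxab a b \is unitarymx) && (\det (mxab a b) == 1).
Proof.
move=> ab1; apply/andP; split; last first.
  rewrite (expand_det_row _ ord0) sum_ord2 /cofactor !det_mx11 !mxE lift20 lift21 /=.
  by rewrite !addn0 addn1 expr0 expr1 mul1r mulN1r opprK -ab1 eqxx.
apply/unitarymxP/matrixP; apply: ord2P; apply: ord2P;
  rewrite !mxE sum_ord2 !mxE/= ?rmorphN ?[Num.conj _]conjcK /=.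
- by [].
- by rewrite [Num.conj _]conjcK; ring.
- by rewrite -[Num.conj a]/(a^*%C) -[Num.conj b]/(b^*%C); ring.
- by rewrite [Num.conj _]conjcK -ab1; ring.
Qed.

Lemma mkSU2P (a b : R[i]) : a * a^*%C + b * b^*%C = 1 ->
  exists x, alpha x = a /\ beta x = b.
Proof.
by move=> /mxab_SU2 ab1; exists (MkSU2 ab1); split; [rewrite /alpha|rewrite /beta]; rewrite /= !mxE /=.
Qed.

(** The real coordinates of a unit quaternion. They are indexed by [nat] so that they can be matched
    on; every index from 3 on gives the last one. *)
Definition qcn (k : nat) x : R :=
  match k with
  | 0 => complex.Re (alpha x) | 1 => complex.Im (alpha x)
  | 2 => complex.Re (beta x) | _ => complex.Im (beta x) end.

Definition qc (k : 'I_4) x := qcn k x.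

(* Sign and index of the entries of left multiplication in the coordinates
   [qc]: the real 4x4 matrix of a quaternion. *)
Definition lmx_index (k l : nat) : bool * nat :=
  match k, l with
  | 0, 0 => (false, 0) | 0, 1 => (true, 1) | 0, 2 => (true, 2) | 0, _ => (true, 3)
  | 1, 0 => (false, 1) | 1, 1 => (false, 0) | 1, 2 => (true, 3) | 1, _ => (false, 2)
  | 2, 0 => (false, 2) | 2, 1 => (false, 3) | 2, 2 => (false, 0) | 2, _ => (true, 1)
  | _, 0 => (false, 3) | _, 1 => (true, 2) | _, 2 => (false, 1) | _, _ => (false, 0)
  end%N.

Definition lmx x (k l : 'I_4) : R :=
  (-1) ^+ (lmx_index k l).1 * qcn (lmx_index k l).2 x.

Lemma qcM k x y : qc k (x * y)%g = \sum_l lmx x k l * qc l y.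
Proof.
rewrite /qc /lmx /= !big_ord_recl big_ord0 /=.
have -> k' : qcn k' (x * y)%g = match k' with
  | 0 => complex.Re (alpha x * alpha y - beta x * (beta y)^*%C)
  | 1 => complex.Im (alpha x * alpha y - beta x * (beta y)^*%C)
  | 2 => complex.Re (alpha x * beta y + beta x * (alpha y)^*%C)
  | _ => complex.Im (alpha x * beta y + beta x * (alpha y)^*%C) end.
  by case: k' => [|[|[|k']]]; rewrite /qcn ?alphaM ?betaM.
case: k => [[|[|[|k]]] lt]; rewrite /qcn /= !expr0 !expr1;
case: (alpha x) (beta x) (alpha y) (beta y) => [a0 a1] [b0 b1] [c0 c1] [d0 d1] /=;
ring.
Qed.

Lemma qcV (k : 'I_4) x : qc k x^-1%g = (-1) ^+ (k != ord0) * qc k x.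
Proof.
rewrite /qc /qcn; case: k => [[|[|[|k]]] lt] /=; rewrite ?alphaV ?betaV.
- by case: (alpha x) => a b /=; rewrite mul1r.
- by case: (alpha x) => a b /=; rewrite mulN1r.
- by case: (beta x) => a b /=; rewrite mulN1r.
- by case: (beta x) => a b /=; rewrite mulN1r.
Qed.

End coordinates.

(** * Borel sets of SU(2) in terms of the real coordinates *)

Section measurable_SU2.
Variable R : realType.
Implicit Types x y : SU2 R.

Lemma Re_norm_le (z : R[i]) : `|complex.Re z|%:C <= `|z|.
Proof. exact: normc_ge_Re. Qed.

Lemma Im_norm_le (z : R[i]) : `|complex.Im z|%:C <= `|z|.
Proof.
have := normc_ge_Re (- (z * 'i%C)); rewrite normrN normrM normCi mulr1.
by rewrite raddfN /= ReiNIm opprK.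
Qed.

Lemma normc_le_ReIm (z : R[i]) : `|z| <= (`|complex.Re z| + `|complex.Im z|)%:C.
Proof.
rewrite {1}[z]complexE (le_trans (ler_normD _ _))// normrM normCi mul1r.
by rewrite !normc_def/= !expr0n/= !addr0 !sqrtr_sqr -rmorphD.
Qed.

Lemma nbhs_box x (U : set (SU2 R)) : open U -> U x ->
  exists2 e : R, 0 < e & forall y, (forall k, `|qc k x - qc k y| < e) -> U y.
Proof.
move=> [V oV <-] Vx.
have /nbhs_ballP[e e0 eV] : nbhs (x : 'M[(R[i] : numClosedFieldType)]_2) V.
  exact: open_nbhs_nbhs.
(* The radius of a ball over the complex numbers is itself complex; its positivity makes it real. *)
have eE : e = (complex.Re e)%:C.
  by move: e0; rewrite /= ltcE => /andP[/eqP/=]; case: e {eV} => a b /= ->.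
have e1 : 0 < complex.Re e by move: e0; rewrite eE /= ltcR.
(* Half the radius, because an entry moves by at most the sum of the moves of its two
   coordinates. *)
exists (complex.Re e / 2); first by rewrite divr_gt0.
move=> y xy; apply: eV; split => //.
have ha : `|alpha x - alpha y| < e.
  apply: (le_lt_trans (normc_le_ReIm _)); rewrite [ltRHS]eE ltcR !raddfB /=.
  rewrite (splitr (complex.Re e)) ltrD//.
    by have := xy ord0.
  by have := xy (inord 1); rewrite /qc /qcn /= inordK.
have hb : `|beta x - beta y| < e.
  apply: (le_lt_trans (normc_le_ReIm _)); rewrite [ltRHS]eE ltcR !raddfB /=.
  rewrite (splitr (complex.Re e)) ltrD//.
    by have := xy (inord 2); rewrite /qc /qcn /= inordK.
  by have := xy (inord 3); rewrite /qc /qcn /= inordK.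
have [x1 x2] := SU2_entries x; have [y1 y2] := SU2_entries y.
apply: ord2P; apply: ord2P; rewrite /ball/=//.
  by rewrite x1 y1 -opprD normrN -rmorphB normcJ.
by rewrite x2 y2 -rmorphB normcJ.
Qed.

Lemma open_entry_gt (f : R[i] -> R) (i j : 'I_2) (a : R) :
  (forall z w, `|f z - f w|%:C <= `|z - w|) ->
  open [set x : SU2 R | a < f (x i j)].
Proof.
move=> fle.
exists [set M : 'M[(R[i] : numClosedFieldType)]_2 | a < f (M i j)] => //.
rewrite openE => M /= aM; apply/nbhs_ballP; exists (f (M i j) - a)%:C => /=.
  by rewrite ltcR subr_gt0.
move=> N [_ /(_ i j)]; rewrite /ball/= => /(le_lt_trans (fle _ _)).
by rewrite ltcR => /(le_lt_trans (ler_norm _)); rewrite ltrBlDr; lra.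
Qed.

Lemma open_qc_gt k (a : R) : open [set x | a < qc k x].
Proof.
have re (z w : R[i]) : `|complex.Re z - complex.Re w|%:C <= `|z - w|.
  by have := Re_norm_le (z - w); rewrite raddfB.
have im (z w : R[i]) : `|complex.Im z - complex.Im w|%:C <= `|z - w|.
  by have := Im_norm_le (z - w); rewrite raddfB.
rewrite /qc /qcn /alpha /beta; case: k => [[|[|[|k]]] lt] /=.
- exact: (open_entry_gt _ _ _ re).
- exact: (open_entry_gt _ _ _ im).
- exact: (open_entry_gt _ _ _ re).
- exact: (open_entry_gt _ _ _ im).
Qed.

Lemma measurable_qc k : measurable_fun setT (@qc R k).
Proof.
apply: (measurability _ (RGenOInfty.measurableE R)) => _ [_ [a ->]] <-.
rewrite setTI; apply: sub_sigma_algebra.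
rewrite (_ : _ @^-1` _ = [set x | a < qc k x]); first exact: open_qc_gt.
by apply/seteqP; split=> x /=; rewrite in_itv/= andbT.
Qed.

(** Lower orthants, chosen because they are stable under intersection and because their indicators
    are products of one-variable indicators. *)
Definition qboxes : set (set (SU2 R)) :=
  [set B | exists a : 'I_4 -> R, B = [set x | forall k, qc k x <= a k]].

Lemma qc_le1 k x : `|qc k x| <= 1.
Proof.
have h : complex.Re (alpha x) ^+ 2 + complex.Im (alpha x) ^+ 2 +
    (complex.Re (beta x) ^+ 2 + complex.Im (beta x) ^+ 2) = 1.
  have := SU2_norm x; case: (alpha x) (beta x) => [a b] [c d] /= [+ _].
  by move=> <-; ring.
rewrite -(@ler_pXn2r _ 2)// ?nnegrE// expr1n real_normK ?num_real//.
by rewrite /qc /qcn; case: k => [[|[|[|]]] lt] /=; nra.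
Qed.

(** For the nontrivial inclusion, an open set is the union of the countably many boxes with rational
    centre and radius 1/(n+1) that it contains. *)
Lemma measurable_qboxes : measurable = <<s qboxes >>.
Proof.
apply/seteqP; split; last first.
  apply: smallest_sub; first exact: sigma_algebra_measurable.
  move=> _ [a ->].
  rewrite (_ : [set x | _] = \bigcap_(k in [set: 'I_4]) (qc k @^-1` `]-oo, a k])).
    apply: fin_bigcap_measurable => // k _.
    by rewrite -[X in measurable X]setTI; exact: measurable_qc.
  by apply/seteqP; split=> x /= h k; [move=> _|]; have := h k; rewrite /= in_itv/=; [|apply].
pose T' := g_sigma_algebraType qboxes.
have mq k : measurable_fun setT (qc k : T' -> R).
  apply: (measurability _ (RGenOInfty.measurableE R)) => _ [_ [a ->]] <-.
  rewrite setTI.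
  (* Coordinates are bounded by 1, so the bound 1 imposes nothing and a half-space is an orthant. *)
  rewrite (_ : _ @^-1` _ = ~` [set x | forall j, qc j x <= if j == k then a else 1]).
    by apply: measurableC; apply: sub_sigma_algebra; eexists; reflexivity.
  apply/seteqP; split=> x /=; rewrite in_itv/= andbT.
    by move=> ax /(_ k); rewrite eqxx leNgt ax.
  move=> h; rewrite ltNge; apply/negP => xa; apply: h => j.
  by case: eqVneq => [->//|_]; exact: le_trans (ler_norm _) (qc_le1 _ _).
apply: smallest_sub; first exact: smallest_sigma_algebra.
move=> U oU.
pose box (c : {ffun 'I_4 -> rat} * nat) : set (SU2 R) :=
  [set y | forall k, `|ratr (c.1 k) - qc k y| < c.2.+1%:R^-1].
rewrite (_ : U = \bigcup_c (if asbool (box c `<=` U) then box c else set0)).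
  apply: (@countable_bigcupT_measurable _ T'); first exact: countableP.
  move=> c; case: asboolP => // _.
  rewrite (_ : box c = \bigcap_(k in [set: 'I_4])
    ((qc k : T' -> R) @^-1` (ball (ratr (c.1 k) : R) c.2.+1%:R^-1))).
    apply: fin_bigcap_measurable => // k _.
    rewrite -[X in measurable X]setTI; apply: (mq k) => //.
    exact: measurable_ball.
  by apply/seteqP; split=> x /= h k; [move=> _|]; exact: h.
apply/seteqP; split=> x; last first.
  by move=> [c _]; case: asboolP => // h; exact: h.
move=> Ux; have [e e0 eU] := nbhs_box oU Ux.
have [n ne] : exists n : nat, n.+1%:R^-1 < e / 2.
  have e20 : 0 < e / 2 by rewrite divr_gt0.
  by have [n _ /(_ n (leqnn n))] := near_infty_natSinv_lt (PosNum e20); exists n.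
have /choice[c cP] k : exists r : rat, `|ratr r - qc k x| < n.+1%:R^-1.
  have /rat_in_itvoo[r] : qc k x < qc k x + n.+1%:R^-1 by rewrite ltrDl invr_gt0.
  rewrite in_itv/= => /andP[r1 r2]; exists r.
  by rewrite ger0_norm ?subr_ge0 ?(ltW r1)// ltrBlDl.
exists ([ffun k => c k], n) => //; case: asboolP => [_ k|].
  by rewrite ffunE.
case=> y yb; apply: eU => k.
have := yb k; have := cP k; rewrite /= ffunE distrC => h1 h2.
apply: le_lt_trans (ler_distD (ratr (c k)) _ _) _.
by rewrite (splitr e) ltrD// (lt_trans _ ne).
Qed.

End measurable_SU2.

(** * Polynomials determine integrable functions *)

Section step.
Variable R : realType.
Implicit Types a t x : R.

Lemma bernoulli_ge x n : -1 <= x -> 1 + n%:R * x <= (1 + x) ^+ n.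
Proof.
move=> x1; elim: n => [|n ih]; first by rewrite mul0r addr0 expr0.
rewrite exprS; apply: le_trans (ler_wpM2l _ ih); last by lra.
by rewrite -natr1; have := sqr_ge0 x; rewrite expr2; have := ler0n R n; nra.
Qed.

Lemma inv1D_ge x : 0 < x -> 1 - x <= (1 + x)^-1.
Proof. by move=> x0; rewrite -div1r ler_pdivlMr; [nra|lra]. Qed.

(* Polynomials in [t], as in the proof of the Stone-Weierstrass theorem:
   [(1 - p^m)^(2^m)] tends to 1 where [p < 1/2] and to 0 where [p > 1/2]. *)
Definition step_arg a j t : R :=
  2^-1 + (t - a - j.+1%:R^-1) / (2 * (`|a| + 3)).
Definition step_poly a j t : R :=
  (1 - step_arg a j t ^+ (j.+1 ^ 2)) ^+ (2 ^ (j.+1 ^ 2)).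

Lemma step_arg01 a j t : `|t| <= 1 -> 0 <= step_arg a j t <= 1.
Proof.
move=> t1; have C0 : 0 < 2 * (`|a| + 3) by have := normr_ge0 a; lra.
have h : `|(t - a - j.+1%:R^-1) / (2 * (`|a| + 3))| <= 2^-1.
  rewrite normrM [X in _ * X]gtr0_norm ?invr_gt0// ler_pdivrMr//.
  have j1 : `|j.+1%:R^-1 : R| <= 1 by rewrite ger0_norm// invf_le1// ler1n.
  have := ler_normB (t - a) j.+1%:R^-1; have := ler_normB t a.
  move: j1; move: (`|t - a - _|) => u; move: (`|t - a|) => v; move: (`|_^-1|) => w.
  lra.
move: h; rewrite ler_norml /step_arg; move: (_ / (2 * _)) => u /andP[h1 h2].
by apply/andP; split; lra.
Qed.

Lemma step_poly01 a j t : `|t| <= 1 -> `|step_poly a j t| <= 1.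
Proof.
move=> /(step_arg01 a j)/andP[p0 p1].
have /andP[p2 p3] : 0 <= step_arg a j t ^+ (j.+1 ^ 2) <= 1 by rewrite exprn_ge0//= exprn_ile1.
by rewrite /step_poly normrX exprn_ile1// ger0_norm; lra.
Qed.

(** The shift by 1/(j+1) in [step_arg] keeps p below 1/2 even at t = a: with d = 1/(C(j+1)) one has
    2p <= 1 - d <= 1/(1+d). Bernoulli bounds the error by (2p)^m, and again (1+d)^m >= md = (j+1)/C,
    since the exponent m = (j+1)^2 outgrows 1/d. *)
Lemma step_poly_le a j t : `|t| <= 1 -> t <= a ->
  `|1 - step_poly a j t| <= (`|a| + 3) * j.+1%:R^-1.
Proof.
move=> t1 ta; have /andP[p0 p1] := step_arg01 a j t1.
have C3 : 3 <= `|a| + 3 by rewrite lerDr.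
set C := `|a| + 3 in C3 *; set p := step_arg a j t in p0 p1 *.
set m := (j.+1 ^ 2)%N.
have /andP[p20 p21] : 0 <= p ^+ m <= 1 by rewrite exprn_ge0//= exprn_ile1.
have sle1 : step_poly a j t <= 1 by exact: le_trans (ler_norm _) (step_poly01 a j t1).
rewrite ger0_norm ?subr_ge0//.
have : 1 - (2 * p) ^+ m <= step_poly a j t.
  rewrite /step_poly -/m -/p exprMn.
  have := @bernoulli_ge (- p ^+ m) (2 ^ m)%N; by rewrite natrX mulrN; apply; rewrite lerN2.
suff h1 : (2 * p) ^+ m <= C * j.+1%:R^-1.
  by move=> h2; apply: le_trans h1; rewrite lerBlDr -lerBlDl.

have j0 : 0 < j.+1%:R :> R by rewrite ltr0n.
have jV0 : 0 < (j.+1%:R^-1 : R) by rewrite invr_gt0.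
pose d := j.+1%:R^-1 / C.
have d0 : 0 < d by rewrite divr_gt0//; lra.
have pd : 2 * p <= 1 - d.
  rewrite /p /step_arg -/C /d.
  have -> : 2 * (2^-1 + (t - a - j.+1%:R^-1) / (2 * C)) = 1 + (t - a) / C - j.+1%:R^-1 / C.
    by field; lra.
  have : (t - a) / C <= 0 by rewrite pmulr_lle0 ?invr_gt0; lra.
  by move=> h; rewrite lerD2r gerDl.
have pd' : 2 * p <= (1 + d)^-1.
  by apply: le_trans pd _; exact: inv1D_ge.
apply: (@le_trans _ _ ((1 + d)^-1 ^+ m)); first by rewrite lerXn2r ?nnegrE ?invr_ge0; lra.
rewrite exprVn -[leRHS]invrK lef_pV2 ?posrE ?invr_gt0 ?exprn_gt0 ?mulr_gt0//; try lra.
apply: le_trans (bernoulli_ge _ _); last by lra.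
rewrite /d /m natrX expr2 invfM invrK.
have -> : j.+1%:R * j.+1%:R * (j.+1%:R^-1 / C) = C^-1 * j.+1%:R by field; rewrite ?lt0r_neq0//; lra.
by lra.
Qed.

(** Here 2p >= 1 + d with d = e/(2C). Since 1 - p^m <= 1/(1+p^m), two uses of Bernoulli give the
    bound 1/(1 + (2p)^m) <= 1/(md), of order 1/(j+1)^2; one factor is given away. *)
Lemma step_poly_gt a j t e : `|t| <= 1 -> 0 < e -> a + e <= t ->
  j.+1%:R^-1 <= e / 2 ->
  `|step_poly a j t| <= (`|a| + 3) * 2 / e * j.+1%:R^-1.
Proof.
move=> t1 e0 ta je; have /andP[p0 p1] := step_arg01 a j t1.
have C3 : 3 <= `|a| + 3 by rewrite lerDr.
set C := `|a| + 3 in C3 *; set p := step_arg a j t in p0 p1 *.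
set m := (j.+1 ^ 2)%N.
have C0 : 0 < C by lra.
have /andP[p20 p21] : 0 <= p ^+ m <= 1 by rewrite exprn_ge0//= exprn_ile1.
have j0 : 0 < j.+1%:R :> R by rewrite ltr0n.
rewrite ger0_norm; last by rewrite exprn_ge0// subr_ge0.
pose d := e / (2 * C).
have d0 : 0 < d by rewrite divr_gt0//; lra.
have pd : 1 + d <= 2 * p.
  rewrite /p /step_arg -/C /d.
  have -> : 2 * (2^-1 + (t - a - j.+1%:R^-1) / (2 * C)) = 1 + (t - a - j.+1%:R^-1) / C.
    by field; lra.
  have -> : e / (2 * C) = (e / 2) / C by field; lra.
  by rewrite lerD2l ler_pM2r ?invr_gt0//; move: je; move: (_^-1) => u; lra.
have md : 0 < m%:R * d by rewrite mulr_gt0// /m ltr0n expn_gt0.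
have pm0 : 0 < (2 * p) ^+ m by rewrite exprn_gt0//; lra.
apply: (@le_trans _ _ ((1 + p ^+ m)^-1 ^+ (2 ^ m))).
  rewrite /step_poly -/m -/p lerXn2r ?nnegrE ?invr_ge0 ?subr_ge0//; first by lra.
  have [->|pm] := eqVneq (p ^+ m) 0; first by rewrite subr0 addr0 invr1.
  by apply: inv1D_ge; rewrite lt_def pm.
rewrite exprVn.
apply: (@le_trans _ _ (m%:R * d)^-1); last first.
  rewrite /d /m natrX expr2 !invfM !invrK.
  have -> : j.+1%:R^-1 / j.+1%:R * (e^-1 * (2 * C)) =
    C * 2 / e * j.+1%:R^-1 * j.+1%:R^-1 by field; rewrite !lt0r_neq0.
  rewrite ger_pMr ?mulr_gt0 ?invr_gt0//.
  by rewrite invf_le1// ler1n.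
rewrite lef_pV2 ?posrE ?exprn_gt0//; last by lra.
apply: le_trans (bernoulli_ge _ _); last by lra.
rewrite natrX -exprMn.
apply: (@le_trans _ _ ((2 * p) ^+ m)); last by rewrite lerDr.
apply: (@le_trans _ _ ((1 + d) ^+ m)); last by rewrite lerXn2r ?nnegrE//; lra.
by apply: le_trans (bernoulli_ge _ _); [rewrite lerDr|lra].
Qed.

Lemma cvg_mul_harmonic (c : R) : c * j.+1%:R^-1 @[j --> \oo] --> (0 : R).
Proof.
rewrite -[X in _ --> X](mulr0 c); apply: cvgM; first exact: cvg_cst.
exact: cvg_harmonic.
Qed.

Lemma step_poly_cvg a t : `|t| <= 1 ->
  step_poly a j t @[j --> \oo] --> ((t <= a)%R%:R : R).
Proof.
move=> t1; have [ta|ta] := lerP t a.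
  apply/cvgrPdist_le => e e0.
  have /cvgr0_norm_le/(_ _ e0) := cvg_mul_harmonic (`|a| + 3).
  by apply: filterS => j /(le_trans (ler_norm _)); exact/le_trans/step_poly_le.
apply/norm_cvg0P; apply: (squeeze_cvgr _ (cvg_cst 0)
  (cvg_mul_harmonic ((`|a| + 3) * 2 / (t - a)))).
have e0 : 0 < (t - a) / 2 by rewrite divr_gt0// subr_gt0.
have := near_infty_natSinv_lt (PosNum e0); apply: filterS => j /= je.
rewrite normr_ge0 step_poly_gt//; first by rewrite subr_gt0.
  by rewrite addrC subrK.
exact: ltW.
Qed.

End step.

(** * Polynomial functions and moments *)

Section density.
Variable R : realType.
Implicit Types (x y : SU2 R) (f g : SU2 R -> R).

Definition mono (w : seq 'I_4) x : R := \prod_(k <- w) qc k x.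

Inductive polyfun : (SU2 R -> R) -> Prop :=
| polyfun_cst c : polyfun (fun=> c)
| polyfun_qc k : polyfun (qc k)
| polyfunD f g : polyfun f -> polyfun g -> polyfun (fun x => f x + g x)
| polyfunM f g : polyfun f -> polyfun g -> polyfun (fun x => f x * g x).

Lemma polyfunX f n : polyfun f -> polyfun (fun x => f x ^+ n).
Proof.
move=> pf; elim: n => [|n ih]; first exact: polyfun_cst.
by under eq_fun do rewrite exprS; exact: polyfunM.
Qed.

Lemma polyfunZ c f : polyfun f -> polyfun (fun x => c * f x).
Proof. by move=> pf; apply: polyfunM => //; exact: polyfun_cst. Qed.

Lemma polyfunB f g : polyfun f -> polyfun g -> polyfun (fun x => f x - g x).
Proof.
move=> pf pg; under eq_fun do rewrite -mulN1r.
by apply: polyfunD => //; exact: polyfunZ.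
Qed.

Lemma polyfun_sum I (s : seq I) (F : I -> SU2 R -> R) :
  (forall i, polyfun (F i)) -> polyfun (fun x => \sum_(i <- s) F i x).
Proof.
move=> pF; elim: s => [|i s ih].
  by under eq_fun do rewrite big_nil; exact: polyfun_cst.
by under eq_fun do rewrite big_cons; exact: polyfunD.
Qed.

Lemma polyfun_prod I (s : seq I) (F : I -> SU2 R -> R) :
  (forall i, polyfun (F i)) -> polyfun (fun x => \prod_(i <- s) F i x).
Proof.
move=> pF; elim: s => [|i s ih].
  by under eq_fun do rewrite big_nil; exact: polyfun_cst.
by under eq_fun do rewrite big_cons; exact: polyfunM.
Qed.

Lemma polyfun_mono w : polyfun (mono w).
Proof. by apply: polyfun_prod => k; exact: polyfun_qc. Qed.

Lemma polyfun_measurable f : polyfun f -> measurable_fun setT f.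
Proof.
elim=> [c|k|g h _ mg _ mh|g h _ mg _ mh].
- exact: measurable_cst.
- exact: measurable_qc.
- exact: measurable_funD.
- exact: measurable_funM.
Qed.

Lemma polyfun_bounded f : polyfun f -> exists M, forall x, `|f x| <= M.
Proof.
elim=> [c|k|g h _ [M gM] _ [N hN]|g h _ [M gM] _ [N hN]].
- by exists `|c|.
- by exists 1; exact: qc_le1.
- by exists (M + N) => x; exact: le_trans (ler_normD _ _) (lerD _ _).
- by exists (M * N) => x; rewrite normrM ler_pM.
Qed.

Lemma polyfun_span f : polyfun f ->
  exists s : seq (R * seq 'I_4), f = fun x => \sum_(c <- s) c.1 * mono c.2 x.
Proof.
elim=> {f} [c|k|f g _ [s ->] _ [t ->]|f g _ [s ->] _ [t ->]].
- by exists [:: (c, [::])]; apply/funext => x; rewrite big_seq1 /mono big_nil mulr1.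
- by exists [:: (1, [:: k])]; apply/funext => x; rewrite big_seq1 /mono big_seq1 mul1r.
- by exists (s ++ t); apply/funext => x; rewrite big_cat.
- exists [seq (c.1 * d.1, c.2 ++ d.2) | c <- s, d <- t]; apply/funext => x.
  rewrite big_allpairs_dep/= mulr_suml; apply: eq_bigr => c _.
  rewrite mulr_sumr; apply: eq_bigr => d _.
  by rewrite /mono big_cat mulrACA.
Qed.

Lemma bounded_integrable (m : {finite_measure set (SU2 R) -> \bar R}) f :
  measurable_fun setT f -> (exists M, forall x, `|f x| <= M) ->
  m.-integrable setT (EFin \o f).
Proof.
move=> mf [M fM]; apply: measurable_bounded_integrable => //.
  by rewrite -ge0_fin_numE//; exact: fin_num_measure.
by exists M; split; rewrite ?num_real// => N /ltW MN x _; exact: le_trans (fM x) MN.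
Qed.

Lemma polyfun_integrable (m : {finite_measure set (SU2 R) -> \bar R}) f :
  polyfun f -> m.-integrable setT (EFin \o f).
Proof.
move=> pf; apply: bounded_integrable; first exact: polyfun_measurable.
exact: polyfun_bounded.
Qed.

Section moments.
Variables (m : {finite_measure set (SU2 R) -> \bar R}) (f : SU2 R -> R).
Hypothesis fi : m.-integrable setT (EFin \o f).

Lemma integrableM_bounded g : measurable_fun setT g -> (exists M, forall x, `|g x| <= M) ->
  m.-integrable setT (EFin \o (fun x => f x * g x)).
Proof.
move=> mg [M gM]; have := @integrableMl _ _ _ m setT measurableT (EFin \o f) g fi mg.
apply; exists M; split; rewrite ?num_real// => N /ltW MN x _.
exact: le_trans (gM x) MN.
Qed.

Lemma integrableM_polyfun g : polyfun g ->
  m.-integrable setT (EFin \o (fun x => f x * g x)).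
Proof.
move=> pg; apply: integrableM_bounded; first exact: polyfun_measurable.
exact: polyfun_bounded.
Qed.

Hypothesis f0 : forall w, Rintegral m setT (fun x => f x * mono w x) = 0.

Lemma polyfun_moment0 g : polyfun g -> (\int[m]_x (f x * g x)%:E = 0)%E.
Proof.
move=> /polyfun_span[s ->].
have f0' w : (\int[m]_x (f x * mono w x)%:E = 0)%E.
  rewrite -[LHS]fineK ?(integrable_fin_num measurableT)//.
    by congr _%:E; exact: f0.
  exact: integrableM_polyfun (polyfun_mono w).
transitivity (\int[m]_x (\sum_(c <- s) c.1%:E * (f x * mono c.2 x)%:E))%E.
  apply: eq_integral => x _; rewrite mulr_sumr -sumEFin.
  by apply: eq_bigr => c _; rewrite -EFinM; congr _%:E; ring.
rewrite integral_sum//=; last first.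
  by move=> c; apply: integrableZl => //; exact: integrableM_polyfun (polyfun_mono _).
rewrite big1// => c _; rewrite integralZl//=; last exact: integrableM_polyfun (polyfun_mono _).
by rewrite f0' mule0.
Qed.

(** Products of step polynomials, one per coordinate, are bounded by 1 and tend pointwise to the
    indicator of the orthant; dominated convergence with bound [|f|] passes the vanishing moments to
    the limit. *)
Lemma qbox_integral0 B : qboxes B -> (\int[m]_(x in B) (f x)%:E = 0)%E.
Proof.
move=> [a BE].
pose h j x := \prod_k step_poly (a k) j (qc k x).
have ph j : polyfun (h j).
  apply: polyfun_prod => k; apply/polyfunX/polyfunB; first exact: polyfun_cst.
  apply: polyfunX; apply: polyfunD; first exact: polyfun_cst.
  apply: polyfunM; last exact: polyfun_cst.
  do 2 (apply: polyfunB; last exact: polyfun_cst).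
  exact: polyfun_qc.
have mB : measurable B by rewrite measurable_qboxes; apply: sub_sigma_algebra; exists a.
have mf : measurable_fun setT f by apply/measurable_EFinP; exact: measurable_int fi.
have : ((\int[m]_x (f x * h j x)%:E)%E @[j --> \oo] --> (\int[m]_x (f x * \1_B x)%:E)%E)%classic.
  have [] := @dominated_convergence _ _ _ m setT measurableT
    (fun j x => (f x * h j x)%:E) (fun x => (f x * \1_B x)%:E) (fun x => `|f x|%:E).
  - move=> j; apply/measurable_EFinP; apply: measurable_funM => //.
    exact: polyfun_measurable.
  - by apply/measurable_EFinP; apply: measurable_funM => //; exact: measurable_indic.
  - apply: aeW => x _; apply: cvg_EFin; first exact: nearW.
    apply: cvgM; first exact: cvg_cst.
    have -> : \1_B x = \prod_k ((qc k x <= a k)%R%:R : R).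
      rewrite indicE; have [xB|xB] := boolP (x \in B).
        by rewrite big1// => k _; move: xB; rewrite inE BE => /(_ k) ->.
      apply/esym/eqP; rewrite prodf_seq_eq0; apply/hasP.
      move: xB; rewrite notin_setE BE /= => /existsNP[k /negP kx].
      by exists k; rewrite ?mem_index_enum// (negbTE kx).
    apply: cvg_big => [|k _]; first exact: mul_continuous.
    by apply: step_poly_cvg; exact: qc_le1.
  - exact: (integrable_norm fi).
  - apply: aeW => x j _; rewrite lee_fin /h normrM ler_piMr// normr_prod.
    by apply: prodr_ile1 => k _; rewrite normr_ge0 step_poly01// qc_le1.
  - by [].
have -> : (fun j => \int[m]_x (f x * h j x)%:E)%E = (fun=> 0%E).
  by apply/funext => j; exact: polyfun_moment0.
have -> : (\int[m]_x (f x * \1_B x)%:E = \int[m]_(x in B) (f x)%:E)%E.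
  rewrite [RHS]integral_mkcond; apply: eq_integral => x _.
  by rewrite patchE indicE; case: ifPn; rewrite ?mulr1 ?mulr0.
by move=> /cvg_lim; rewrite lim_cst => // /(_ (@ereal_hausdorff R)).
Qed.

(** The sets over which f integrates to 0 form a Dynkin system containing the orthants, hence
    comprise all Borel sets. *)
Lemma moments0_ae_eq0 : ae_eq m setT (EFin \o f) (cst 0%E).
Proof.
apply: integral_ae_eq => //.
have fE E : measurable E -> m.-integrable E (EFin \o f).
  by move=> mE; apply: integrableS fi.
have boxT : qboxes [set: SU2 R].
  exists (fun=> 1); apply/seteqP; split=> x //= _ k.
  exact: le_trans (ler_norm _) (qc_le1 _ _).
move=> E _ mE; rewrite [RHS]integral0.
have := @dynkin_induction _ _ (@qboxes R)
  (fun E => (\int[m]_(x in E) (f x)%:E = 0)%E) (@measurable_qboxes R).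
apply; last by rewrite -measurable_qboxes.
- move=> _ _ [a ->] [b ->]; exists (fun k => Num.min (a k) (b k)).
  by apply/seteqP; split=> x /= => [[h1 h2] k|h]; [rewrite le_min h1 h2|
    split=> k; have := h k; rewrite le_min => /andP[]].
- exact: qbox_integral0.
- by move=> B; exact: qbox_integral0.
- move=> S mS S0.
  have := @integral_setU _ _ _ m S (~` S) (fun x => (f x)%:E) mS (measurableC mS).
  rewrite setUv (qbox_integral0 boxT) S0 add0e => <- //.
    exact: measurable_int fi.
  by rewrite disj_set2E setICr.
- move=> F mF tF F0; rewrite integral_bigcup//.
    by rewrite eseries0.
  by apply: fE; exact: bigcup_measurable.
Qed.

End moments.
End density.

(** * Haar measure and null sets *)

Section sections.
Context d1 d2 (T1 : measurableType d1) (T2 : measurableType d2) (R : realType).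

Lemma integral_sections (m1 : {sigma_finite_measure set T1 -> \bar R})
    (m2 : {sigma_finite_measure set T2 -> \bar R}) (A : set (T1 * T2)) :
  measurable A ->
  (\int[m1]_x m2 (pair x @^-1` A) = \int[m2]_y m1 (pair^~ y @^-1` A))%E.
Proof.
move=> mA; have := indic_fubini_tonelli m1 m2 mA.
rewrite indic_fubini_tonelli_FE// indic_fubini_tonelli_GE//= => e.
under eq_integral do rewrite -xsectionE; rewrite e.
by apply: eq_integral => y _; rewrite -ysectionE.
Qed.

End sections.

Lemma qcn_qc (R : realType) k : exists j : 'I_4, @qcn R k = qc j.
Proof.
exists (inord (minn k 3)); apply/funext => x.
rewrite /qc inordK; last by rewrite ltnS geq_minr.
by case: k => [|[|[|k]]].
Qed.

Section measurable_group.
Variable R : realType.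
Context d (T : measurableType d).
Implicit Types f g : T -> SU2 R.

Lemma measurable_SU2 f : (forall k, measurable_fun setT (fun t => qc k (f t))) ->
  measurable_fun setT f.
Proof.
move=> mf; apply: (measurability _ (@measurable_qboxes R)) => _ [_ [a ->]] <-.
rewrite setTI.
rewrite (_ : _ @^-1` _ = \bigcap_(k in [set: 'I_4])
  ((fun t => qc k (f t)) @^-1` `]-oo, a k])).
  apply: fin_bigcap_measurable => // k _.
  by rewrite -[X in measurable X]setTI; exact: mf.
by apply/seteqP; split=> x /= h k; [move=> _|]; have := h k; rewrite /= in_itv/=; [|apply].
Qed.

Lemma measurable_qcn f k : measurable_fun setT f ->
  measurable_fun setT (fun t => qcn k (f t)).
Proof.
move=> mf.
have [j ->] := @qcn_qc R k; apply: measurableT_comp => //; exact: measurable_qc.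
Qed.

Lemma measurable_lmx f k l : measurable_fun setT f ->
  measurable_fun setT (fun t => lmx (f t) k l).
Proof. by move=> mf; apply: measurable_funM => //; exact: measurable_qcn. Qed.

Lemma measurable_mulg f g : measurable_fun setT f -> measurable_fun setT g ->
  measurable_fun setT (fun t => (f t * g t)%g).
Proof.
move=> mf mg; apply: measurable_SU2 => k.
under eq_fun do rewrite qcM.
apply: measurable_sum => l; apply: measurable_funM; first exact: measurable_lmx.
by apply: measurableT_comp => //; exact: measurable_qc.
Qed.

Lemma measurable_invg f : measurable_fun setT f ->
  measurable_fun setT (fun t => (f t)^-1%g).
Proof.
move=> mf; apply: measurable_SU2 => k.
under eq_fun do rewrite qcV.
apply: measurable_funM => //.
by apply: measurableT_comp => //; exact: measurable_qc.
Qed.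

Lemma measurable_expg f n : measurable_fun setT f ->
  measurable_fun setT (fun t => (f t ^+ n)%g).
Proof.
move=> mf; elim: n => [|n ih].
  by under eq_fun do rewrite expg0; exact: measurable_cst.
by under eq_fun do rewrite expgS; exact: measurable_mulg.
Qed.

Lemma measurable_eqg f g : measurable_fun setT f -> measurable_fun setT g ->
  measurable [set t | f t = g t].
Proof.
move=> mf mg.
rewrite (_ : mkset _ = \bigcap_(k in [set: 'I_4])
   ((fun t => qc k (f t) - qc k (g t)) @^-1` [set 0])).
  apply: fin_bigcap_measurable => // k _.
  rewrite -[X in measurable X]setTI; apply: measurable_funB => //;
    by apply: measurableT_comp => //; exact: measurable_qc.
apply/seteqP; split=> t /=; first by move=> e k _; rewrite /= e subrr.
move=> h; have {}h k : qc k (f t) = qc k (g t).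
  by apply/eqP; rewrite -subr_eq0; apply/eqP; exact: h.
apply: SU2_ext; apply/eqP; rewrite eq_complex; apply/andP; split; apply/eqP.
- exact: (h ord0).
- by have := h (inord 1); rewrite /qc inordK.
- by have := h (inord 2); rewrite /qc inordK.
- by have := h (inord 3); rewrite /qc inordK.
Qed.

End measurable_group.

Section haar.
Variables (R : realType) (mu : probability (SU2 R) R).
Hypothesis haar : left_invariant mu.
Implicit Types (g x y : SU2 R) (A B : set (SU2 R)).

Lemma measurable_preimage d (T : measurableType d) (f : T -> SU2 R) A :
  measurable_fun setT f -> measurable A -> measurable (f @^-1` A).
Proof. by move=> mf mA; rewrite -[X in measurable X]setTI; exact: mf. Qed.

(** Tonelli applied to the set of pairs with x^-1 y in A: its sections at fixed x are translates of
    A, those at fixed y are translates of the inverse of A. *)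
Lemma haar_inv A : measurable A -> mu ((fun x => x^-1%g) @^-1` A) = mu A.
Proof.
move=> mA.
have mu1 : mu [set: SU2 R] = 1%E by exact: probability_setT.
pose E := (fun p : SU2 R * SU2 R => (p.1^-1 * p.2)%g) @^-1` A.
have mE : measurable E.
  by apply: measurable_preimage => //; apply: measurable_mulg => //; exact: measurable_invg.
have := integral_sections mu mu mE.
rewrite (eq_integral (fun=> mu A)); last by move=> x _; exact: (haar x^-1%g mA).
rewrite integral_cst// [X in (_ * X)%E]mu1 mule1 => ->.
have mAV : measurable ((fun x => x^-1%g) @^-1` A).
  by apply: measurable_preimage => //; exact: measurable_invg.
rewrite (eq_integral (fun=> mu ((fun x => x^-1%g) @^-1` A))).
  by rewrite integral_cst// [X in (_ * X)%E]mu1 mule1.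
move=> y _; rewrite -[RHS](haar y^-1%g mAV); congr (mu _).
by apply/funext => x; rewrite /E /preimage/= invgM invgK.
Qed.

Lemma haar_mulr g A : measurable A -> mu ((fun x => (x * g)%g) @^-1` A) = mu A.
Proof.
move=> mA.
have mAV : measurable ((fun x => x^-1%g) @^-1` A).
  by apply: measurable_preimage => //; exact: measurable_invg.
have mAg : measurable ((fun x => (x * g)%g) @^-1` A).
  by apply: measurable_preimage => //; exact: measurable_mulg.
rewrite -(haar_inv mAg) -(haar_inv mA) -(haar g^-1%g mAV); congr (mu _).
by apply/funext => x; rewrite /preimage/= invgM invgK.
Qed.

(** The union of n translates has measure n times that of A, and a probability is at most 1. *)
Lemma null_ae_disjoint_translates (g : nat -> SU2 R) A : measurable A ->
  (forall i j, i != j ->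
    mu ((fun x => (g i * x)%g) @^-1` A `&` (fun x => (g j * x)%g) @^-1` A) = 0%E) ->
  mu A = 0%E.
Proof.
move=> mA disj; set B := fun i => (fun x => (g i * x)%g) @^-1` A.
have mB i : measurable (B i).
  by apply: measurable_preimage => //; exact: measurable_mulg.
pose X n := \big[setU/set0]_(i < n) B i.
have mX n : measurable (X n) by exact: bigsetU_measurable.
have XB n j : (n <= j)%N -> mu (X n `&` B j) = 0%E.
  elim: n => [_|n ih nj]; first by rewrite /X big_ord0 set0I measure0.
  rewrite /X big_ord_recr/= setIUl measureU0; first exact: ih (ltnW nj).
  - by apply: measurableI => //; exact: mX.
  - exact: measurableI.
  - by apply: disj; rewrite ltn_eqF.
have muX n : mu (X n) = (mu A *+ n)%E.
  elim: n => [|n ih]; first by rewrite /X big_ord0 measure0 mule0n.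
  have XS : X n.+1 = X n `|` B n by rewrite /X big_ord_recr.
  have Xoo : (mu (X n) < +oo)%E.
    exact: le_lt_trans (probability_le1 mu (mX n)) (ltry 1).
  have -> : mu (X n.+1) = (mu (X n) + mu (B n) - mu (X n `&` B n))%E.
    by rewrite XS; exact: measureUfinl.
  by rewrite XB// sube0 ih (haar _ mA) addeC muleS.
apply/eqP; rewrite eq_le measure_ge0 andbT leNgt; apply/negP => A0.
have Afin : mu A \is a fin_num by rewrite fin_num_measure.
move: A0 muX; rewrite -(fineK Afin); set c := fine _; rewrite lte_fin => c0 muX.
have [n cn] : exists n : nat, 1 < c *+ n.
  exists (Num.bound c^-1); rewrite -mulr_natr -ltr_pdivrMl// mulr1.
  by apply: archi_boundP; rewrite invr_ge0 ltW.
have := probability_le1 mu (mX n).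
by rewrite muX -EFin_natmul lee_fin leNgt cn.
Qed.

End haar.

(** * Conjugation into the diagonal torus *)

Section diagonal.
Variable R : realType.
Implicit Types x y : SU2 R.

Lemma mkSU2_scaled (p q : R[i]) : (p != 0) || (q != 0) ->
  exists x (c : R), [/\ 0 < c, alpha x = p * c%:C & beta x = q * c%:C].
Proof.
case: p q => [a b] [c d] pq0.
pose n2 := a ^+ 2 + b ^+ 2 + (c ^+ 2 + d ^+ 2).
have n20 : 0 < n2.
  rewrite lt_def !addr_ge0 ?sqr_ge0// andbT; apply: contraL pq0.
  rewrite !paddr_eq0 ?addr_ge0 ?sqr_ge0// !sqrf_eq0 !eq_complex /=.
  by move=> /andP[/andP[-> ->] /andP[-> ->]].
pose k := (Num.sqrt n2)^-1.
have k2 : k ^+ 2 * n2 = 1.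
  by rewrite exprVn sqr_sqrtr ?(ltW n20)// mulVf ?gt_eqF.
have [|x [xa xb]] := @mkSU2P R ((a +i* b) * k%:C) ((c +i* d) * k%:C).
  apply/eqP; rewrite eq_complex /=; apply/andP; split; apply/eqP; last by ring.
  by rewrite -k2 /n2; ring.
by exists x, k; split => //; rewrite invr_gt0 sqrtr_gt0.
Qed.

Lemma SU2_diagonal x : exists s, beta (s^-1 * x * s)%g = 0.
Proof.
have [b0|b0] := eqVneq (beta x) 0.
  by exists 1%g; rewrite mulg1 invg1 mul1g.
(* [z] solves the quadratic equation saying that the row vector (z, 1) is
   an eigenvector of the transpose of [x]. *)
have [z hz] : exists z : R[i], beta x * z ^+ 2 - (alpha x - (alpha x)^*%C) * z
    + (beta x)^*%C = 0.
  have [z] := @solve_monicpoly R[i] 2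
    (fun i => if i == 0%N then - (beta x)^*%C / beta x
              else (alpha x - (alpha x)^*%C) / beta x) isT.
  rewrite !big_ord_recl big_ord0 /= expr0 expr1 mulr1 addr0 => hz; exists z.
  rewrite hz /bump /=; field.
  exact: b0.
have [|s [c [c0 sa sb]]] := @mkSU2_scaled (z^*%C) (- 1).
  by rewrite oppr_eq0 oner_eq0 orbT.
exists s.
rewrite betaM alphaM betaM alphaV betaV sa sb !(conjcM, conjcD, conjcN, conjcK).
rewrite conjc_real.
transitivity ((c%:C) ^+ 2 * (beta x * z ^+ 2 - (alpha x - (alpha x)^*%C) * z
    + (beta x)^*%C)); last by rewrite hz mulr0.
ring.
Qed.

End diagonal.

(** * Null sets of Haar measure and generic pairs *)

Section null_sets.
Variables (R : realType) (mu : probability (SU2 R) R).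
Hypothesis haar : left_invariant mu.
Implicit Types (g x y : SU2 R) (A B : set (SU2 R)).

(** An explicit infinite family in the torus: the slope j distinguishes the members, and [c j] is
    only the normalization. *)
Lemma diag_seq : exists (t : nat -> SU2 R) (c : nat -> R), forall j,
  [/\ 0 < c j, alpha (t j) = (1 +i* j%:R) * (c j)%:C & beta (t j) = 0].
Proof.
have /choice[t /choice[c tc]] (j : nat) : exists x (c : R),
    [/\ 0 < c, alpha x = (1 +i* j%:R) * c%:C & beta x = 0].
  have [|x [c [c0 xa xb]]] := @mkSU2_scaled R (1 +i* j%:R) 0.
    by rewrite eq_complex /= oner_eq0.
  by exists x, c; split => //; rewrite xb mul0r.
by exists t, c.
Qed.

Lemma rot_seq : exists (t : nat -> SU2 R) (c : nat -> R), forall j,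
  [/\ 0 < c j, alpha (t j) = (c j)%:C & beta (t j) = j%:R * (c j)%:C].
Proof.
have /choice[t /choice[c tc]] (j : nat) : exists x (c : R),
    [/\ 0 < c, alpha x = c%:C & beta x = j%:R * c%:C].
  have [|x [c [c0 xa xb]]] := @mkSU2_scaled R 1 j%:R.
    by rewrite oner_eq0.
  by exists x, c; split => //; rewrite xa mul1r.
by exists t, c.
Qed.

Lemma measurable_set1_SU2 x : measurable [set x].
Proof. exact: (@measurable_eqg R _ (SU2 R) id (cst x)). Qed.

Lemma null_point x : mu [set x] = 0%E.
Proof.
have [t [c tc]] := diag_seq.
apply: (null_ae_disjoint_translates haar (g := t)); first exact: measurable_set1_SU2.
move=> i j ij; rewrite [X in mu X](_ : _ = set0) ?measure0//.
apply/seteqP; split=> // y [/= yi yj].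
have /(congr1 (fun x => alpha x)) : t i = t j by apply: (@mulIg _ y); rewrite yi yj.
have [ci -> _] := tc i; have [cj -> _] := tc j.
move=> /eqP; rewrite eq_complex /= !mulr0 !mul1r subr0 add0r => /andP[/eqP ->].
by rewrite subr0 add0r (inj_eq (mulIf (lt0r_neq0 cj))) eqr_nat (negbTE ij).
Qed.

Lemma null_subsingleton A : measurable A ->
  (forall x y, A x -> A y -> x = y) -> mu A = 0%E.
Proof.
move=> mA A1; have [[x Ax]|A0] := pselect (exists x, A x).
  apply: (@subset_measure0 _ _ _ mu _ [set x]) => //.
  - exact: measurable_set1_SU2.
  - by move=> y Ay /=; exact: A1.
  - exact: null_point.
rewrite (_ : A = set0) ?measure0//; apply/seteqP; split=> // x Ax.
by apply: A0; exists x.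
Qed.

Lemma measurable_qcn_eq k (r : R) : measurable [set x : SU2 R | qcn k x = r].
Proof.
rewrite (_ : mkset _ = (fun x => qcn k x) @^-1` [set r])//.
by rewrite -[X in measurable X]setTI; apply: measurable_qcn.
Qed.

Lemma measurable_alpha_eq w : measurable [set x : SU2 R | alpha x = w].
Proof.
rewrite (_ : mkset _ = [set x | qcn 0 x = complex.Re w] `&`
                       [set x | qcn 1 x = complex.Im w]).
  by apply: measurableI; exact: measurable_qcn_eq.
apply/seteqP; split=> x /=; first by move=> ->.
by move=> [h1 h2]; apply/eqP; rewrite eq_complex; apply/andP; split; apply/eqP.
Qed.

(** Membership of x in the k-th translate is one affine equation in alpha x and the conjugate of
    beta x, with slope k. Two different slopes determine x, so two translates share at most one
    point. *)
Lemma null_alpha_eq w : mu [set x | alpha x = w] = 0%E.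
Proof.
have [t [c tc]] := rot_seq.
have mw := measurable_alpha_eq w.
apply: (null_ae_disjoint_translates haar (g := t)) => // i j ij.
apply: null_subsingleton.
  by apply: measurableI; apply: measurable_preimage => //; exact: measurable_mulg.
move=> x y [/= xi xj] [/= yi yj].
have h k : (alpha (t k * x)%g = w) -> (alpha (t k * y)%g = w) ->
    alpha x - alpha y = k%:R * ((beta x)^*%C - (beta y)^*%C).
  rewrite !alphaM; have [ck -> ->] := tc k => <- e.
  have c0 : (c k)%:C != 0 by rewrite eq_complex /= eqxx andbT gt_eqF.
  by apply: (mulfI c0); apply/eqP; rewrite -subr_eq0; apply/eqP; rewrite -[RHS](subrr ((c k)%:C * alpha y - k%:R * (c k)%:C * (beta y)^*%C)) [in X in _ = X - _]e; ring.
have bxy : beta x = beta y.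
  apply/eqP; rewrite -subr_eq0 -conjc_eq0 conjcD conjcN.
  have : (i%:R - j%:R) * ((beta x)^*%C - (beta y)^*%C) = 0.
    by rewrite mulrBl -(h i)// -(h j)// subrr.
  move=> /eqP; rewrite mulf_eq0 subr_eq0 eqr_nat (negbTE ij) /=.
  by [].
apply: SU2_ext => //; apply/eqP; rewrite -subr_eq0 (h i)//.
by rewrite bxy subrr mulr0.
Qed.

(** The same device one dimension up: two translates fix both the real and the imaginary part of
    alpha, so their intersection lies in a level set of [alpha], already known to be null. *)
Lemma null_Re_alpha_eq r : mu [set x | qcn 0 x = r] = 0%E.
Proof.
have [t [c tc]] := diag_seq.
have mr := measurable_qcn_eq 0 r.
apply: (null_ae_disjoint_translates haar (g := t)) => // i j ij.
set I := _ `&` _.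
have mI : measurable I.
  by apply: measurableI; apply: measurable_preimage => //; exact: measurable_mulg.
have [[x Ix]|I0] := pselect (exists x, I x); last first.
  rewrite (_ : I = set0) ?measure0//; apply/seteqP; split=> // x Ix.
  by apply: I0; exists x.
apply: (@subset_measure0 _ _ _ mu _ [set y | alpha y = alpha x]) => //.
  exact: measurable_alpha_eq.
  move=> y [/= yi yj]; have [/= xi xj] := Ix.
  have h k : qcn 0 (t k * x)%g = r -> qcn 0 (t k * y)%g = r ->
      complex.Re (alpha y) - complex.Re (alpha x) =
      k%:R * (complex.Im (alpha y) - complex.Im (alpha x)).
    have e z : complex.Re ((1 +i* k%:R) * (c k)%:C * z) =
        c k * (complex.Re z - k%:R * complex.Im z).
      by case: z => a b /=; ring.
    rewrite /qcn !alphaM; have [ck -> ->] := tc k.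
    rewrite !mul0r !subr0 !e => <- /(mulfI (lt0r_neq0 ck)) exy.
    by lra.
  have bxy : complex.Im (alpha y) = complex.Im (alpha x).
    have /eqP : (i%:R - j%:R) * (complex.Im (alpha y) - complex.Im (alpha x)) = 0.
      by rewrite mulrBl -(h i)// -(h j)// subrr.
    by rewrite mulf_eq0 subr_eq0 eqr_nat (negbTE ij) /= subr_eq0 => /eqP.
  apply/eqP; rewrite eq_complex bxy eqxx andbT -subr_eq0 (h i)//.
  by rewrite bxy subrr mulr0.
exact: null_alpha_eq.
Qed.

Lemma null_beta_eq0 : mu [set x | beta x = 0] = 0%E.
Proof.
have [|J [Ja Jb]] := @mkSU2P R 0 1; first by rewrite mul0r add0r mul1r rmorph1.
rewrite -(null_alpha_eq 0) -(haar J (measurable_alpha_eq 0)); congr (mu _).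
apply/seteqP; split=> x /=; rewrite alphaM Ja Jb mul0r add0r mul1r.
  by move=> ->; rewrite conjc0 oppr0.
by move/eqP; rewrite oppr_eq0 conjc_eq0 => /eqP.
Qed.

Lemma measurable_beta_eq0 : measurable [set y : SU2 R | beta y = 0].
Proof.
rewrite (_ : mkset _ = [set x | qcn 2 x = 0] `&` [set x | qcn 3 x = 0]).
  by apply: measurableI; exact: measurable_qcn_eq.
apply/seteqP; split=> x /=; first by rewrite /qcn => ->.
by move=> [h1 h2]; apply/eqP; rewrite eq_complex; apply/andP; split; apply/eqP.
Qed.

Lemma measurable_conj_beta_eq0 s :
  measurable [set y : SU2 R | beta (s^-1 * y * s)%g = 0].
Proof.
apply: (@measurable_preimage _ _ _ (fun y => (s^-1 * y * s)%g) _ _ measurable_beta_eq0).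
by apply: measurable_mulg => //; exact: measurable_mulg.
Qed.

Lemma null_conj_beta_eq0 s : mu [set y | beta (s^-1 * y * s)%g = 0] = 0%E.
Proof.
have mb := measurable_beta_eq0.
have mbs : measurable ((fun y => (y * s)%g) @^-1` [set y : SU2 R | beta y = 0]).
  by apply: measurable_preimage => //; exact: measurable_mulg.
by rewrite -null_beta_eq0 -(haar_mulr haar s mb) -(haar s^-1%g mbs).
Qed.

(** Chebyshev polynomials of the first kind, in consecutive pairs (T_n, T_(n+1)) because the
    recursion has depth two. *)
Fixpoint cheb (n : nat) : {poly R} * {poly R} :=
  if n is m.+1 then let: (p, q) := cheb m in (q, 2%:P * 'X * q - p)
  else (1, 'X).

(** The real part of alpha is half the trace, and x + x^-1 is twice it times the identity; so Re(x
    y) + Re(x^-1 y) = 2 Re(x) Re(y), which is the Chebyshev recursion. *)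
Lemma cheb_Re x n : (cheb n).1.[qcn 0 x] = qcn 0 (x ^+ n)%g /\
  (cheb n).2.[qcn 0 x] = qcn 0 (x ^+ n.+1)%g.
Proof.
elim: n => [|n /=]; first by rewrite /= hornerC hornerX expg0 expg1 /= alpha1.
case: (cheb n) => p q /= [hp hq]; split => //.
rewrite !hornerE hp hq.
set y := (x ^+ n.+1)%g.
have -> : (x ^+ n = x^-1 * y)%g by rewrite /y expgS mulKg.
rewrite expgS -/y /qcn !alphaM alphaV betaV.
by case: (alpha x) (beta x) (alpha y) (beta y) => [a b] [c d] [a' b'] [c' d'] /=; ring.
Qed.

(** Serves to show that T_(n+1) - 1 is not the zero polynomial; the doubling clause makes the
    induction close. *)
Lemma cheb_gt1 n : 1 <= (cheb n).1.[2] /\ 2 * (cheb n).1.[2] <= (cheb n).2.[2].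
Proof.
elim: n => [|n]; first by rewrite /= hornerC hornerX; split; lra.
by rewrite /=; case: (cheb n) => p q /= [h1 h2]; rewrite !hornerE; split; lra.
Qed.

Lemma null_torsion n : mu [set x | (x ^+ n.+1)%g = 1%g] = 0%E.
Proof.
pose p := (cheb n.+1).1 - 1.
have p0 : p != 0.
  apply/eqP => /(congr1 (fun q => q.[2])); rewrite /p !hornerE /=.
  have := cheb_gt1 n; case: (cheb n) => a b /= [h1 h2] h; lra.
apply/negligibleP; first by apply: measurable_eqg => //; exact: measurable_expg.
(* A torsion element has its real part among finitely many roots. Indices past the end of the root
   list give the default 0, whose level set is null as well. *)
apply: (@negligibleS _ _ _ mu
    (\bigcup_k [set x : SU2 R | qcn 0 x = (polyrcf.rootsR p)`_k])); last first.
  apply: negligible_bigcup => k; apply/negligibleP; last exact: null_Re_alpha_eq.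
  exact: measurable_qcn_eq.
move=> x /= xn.
have /nthP-/(_ 0)[k _ kx] : qcn 0 x \in polyrcf.rootsR p.
  have := polyrcf.roots_on_rootsR p0.
  rewrite /polyrcf.roots_on => /(_ (qcn 0 x)) <-.
  rewrite in_itv /= /root /p !hornerE (cheb_Re x n.+1).1 xn /= alpha1 subrr.
  by rewrite eqxx.
by exists k.
Qed.

(* The complementary conditions say that [x] is torsion, or that [y] lies in
   the normalizer of the maximal torus of [x]. *)
Definition good x y := [/\ forall n, (x ^+ n.+1)%g <> 1%g, (x * y <> y * x)%g
  & (y * x * y^-1 <> x^-1)%g].

Lemma measurable_good : measurable [set p : SU2 R * SU2 R | good p.1 p.2].
Proof.
rewrite (_ : mkset _ = (\bigcap_n ~` [set p : SU2 R * SU2 R | (p.1 ^+ n.+1)%g = 1%g])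
  `&` ~` [set p : SU2 R * SU2 R | (p.1 * p.2 = p.2 * p.1)%g]
  `&` ~` [set p : SU2 R * SU2 R | (p.2 * p.1 * p.2^-1 = p.1^-1)%g]).
  have m1 : measurable_fun setT (fun p : SU2 R * SU2 R => p.1) by exact: measurable_fst.
  have m2 : measurable_fun setT (fun p : SU2 R * SU2 R => p.2) by exact: measurable_snd.
  apply: measurableI; first apply: measurableI.
  - apply: bigcapT_measurable => n; apply: measurableC; apply: measurable_eqg => //.
    exact: measurable_expg.
  - by apply: measurableC; apply: measurable_eqg; exact: measurable_mulg.
  - apply: measurableC; apply: measurable_eqg; last exact: measurable_invg.
    by apply: measurable_mulg; [exact: measurable_mulg|exact: measurable_invg].
apply/seteqP; split=> -[x y] /=; rewrite /good /=.
  by move=> [h1 h2 h3]; split => //; split => // n _ /=; exact: h1.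
by move=> [[h1 h2] h3]; split => // n; exact: (h1 n Logic.I).
Qed.

(** After conjugation x becomes a diagonal D different from its inverse. Then z commutes with D only
    if beta z = 0 and inverts D only if alpha z = 0, and both conditions are null. *)
Lemma null_not_good x : (forall n, (x ^+ n.+1)%g <> 1%g) ->
  mu [set y | ~ good x y] = 0%E.
Proof.
move=> xtor.
have mg : measurable [set y | ~ good x y].
  rewrite (_ : mkset _ = pair x @^-1` ~` [set p | good p.1 p.2])//.
  rewrite -[X in measurable X]setTI; apply: pair1_measurable => //.
  exact: measurableC measurable_good.
have [s sx] := SU2_diagonal x.
have [D xD {}sx] : exists2 D, (x = s * D * s^-1)%g & beta D = 0.
  by exists (s^-1 * x * s)%g => //; rewrite !mulgA mulgV mul1g mulgK.
have [J [Ja Jb]] : exists J : SU2 R, alpha J = 0 /\ beta J = 1.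
  by apply: mkSU2P; rewrite conjc1 mul0r add0r mulr1.
(* A real alpha D of modulus 1 would give D^2 = 1, torsion at index 1. *)
have aD : alpha D != (alpha D)^*%C.
  apply/eqP => aD; apply: (xtor 1).
  have D2 : (D ^+ 2 = 1)%g.
    rewrite expgS expg1; apply: SU2_ext.
      rewrite alphaM sx mul0r subr0 alpha1 {2}aD.
      by have := SU2_norm D; rewrite sx mul0r addr0.
    by rewrite betaM sx mulr0 mul0r addr0 beta1.
  rewrite xD expgS expg1 !mulgA mulgVK -(mulgA s D D).
  by have : (D * D = 1)%g by []; move=> ->; rewrite mulg1 mulgV.
apply/negligibleP => //.
have nb := null_conj_beta_eq0 s; have mb := measurable_conj_beta_eq0 s.
(* Left multiplication by J turns alpha z into a beta entry up to conjugation, so the second null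
   set is a translate of the first. *)
apply: (@negligibleS _ _ _ mu ([set y | beta (s^-1 * y * s)%g = 0] `|`
    (fun y => (s * J * s^-1 * y)%g) @^-1` [set y | beta (s^-1 * y * s)%g = 0])); last first.
  apply: negligibleU; apply/negligibleP => //; last by rewrite -[RHS]nb; exact: (haar _ mb).
  by apply: measurable_preimage => //; exact: measurable_mulg.
move=> y ngood.
have [z yz] : exists z, (y = s * z * s^-1)%g.
  by exists (s^-1 * y * s)%g; rewrite !mulgA mulgV mul1g mulgK.
have zE : (s^-1 * y * s = z)%g by rewrite yz !mulgA mulVg mul1g mulgVK.
have [h|h] : (D * z = z * D)%g \/ (z * D = D^-1 * z)%g.
- apply: contrapT => /not_orP[h1 h2]; apply: ngood; split => // e.
    apply: h1; move/(congr1 (fun u => s^-1 * u * s)%g): e.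
    by rewrite xD yz !mulgA !mulgVK !mulVg !mul1g.
  apply: h2; move/(congr1 (fun u => s^-1 * u * y * s)%g): e.
  by rewrite xD yz !invgM !invgK !mulgA !mulgVK !mulVg !mul1g.
- left; rewrite /= zE; move/(congr1 (@beta R)): h.
  rewrite !betaM sx mul0r mulr0 addr0 add0r => /eqP.
  by rewrite mulrC -subr_eq0 -mulrBr mulf_eq0 (subr_eq0 (alpha D)) (negbTE aD) orbF => /eqP.
- right; rewrite /=.
  have -> : (s^-1 * (s * J * s^-1 * y) * s = J * z)%g by rewrite -zE !mulgA mulVg mul1g.
  rewrite betaM Ja Jb mul0r add0r mul1r; move/(congr1 (@alpha R)): h.
  rewrite !alphaM betaV sx conjc0 mulr0 oppr0 mul0r !subr0 alphaV => /eqP.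
  rewrite addr0 mulrC -subr_eq0 -mulrBl mulf_eq0 (subr_eq0 (alpha D)) (negbTE aD) /= => /eqP ->.
  by rewrite conjc0.
Qed.

End null_sets.

(** * Polynomials invariant under two generic elements *)

Section laurent.
Variable R : realType.
Local Notation C := R[i].
Implicit Types (f g : C -> C) (z c : C).

(* On the unit circle, [f] and its conjugate are Laurent polynomials. *)
Definition laurent f := exists N (P Q : {poly C}), forall z, z * z^*%C = 1 ->
  f z * z ^+ N = P.[z] /\ (f z)^*%C * z ^+ N = Q.[z].

Lemma laurent_cst c : laurent (fun=> c).
Proof. by exists 0%N, c%:P, (c^*%C)%:P => z _; rewrite expr0 !mulr1 !hornerC. Qed.

Lemma laurent_id : laurent id.
Proof.
exists 1%N, ('X^2), 1%:P => z z1; rewrite expr1 hornerXn hornerC; split => //.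
by rewrite mulrC.
Qed.

Lemma laurent_conj f : laurent f -> laurent (fun z => (f z)^*%C).
Proof.
by move=> [N [P [Q h]]]; exists N, Q, P => z /h[h1 h2]; rewrite conjcK.
Qed.

Lemma laurentD f g : laurent f -> laurent g -> laurent (fun z => f z + g z).
Proof.
move=> [N [P [Q h]]] [M [P' [Q' h']]].
exists (N + M)%N, (P * 'X^M + P' * 'X^N), (Q * 'X^M + Q' * 'X^N) => z z1.
have [h1 h2] := h _ z1; have [h1' h2'] := h' _ z1.
by rewrite !hornerE -h1 -h2 -h1' -h2' conjcD !exprD; split; ring.
Qed.

Lemma laurentM f g : laurent f -> laurent g -> laurent (fun z => f z * g z).
Proof.
move=> [N [P [Q h]]] [M [P' [Q' h']]].
exists (N + M)%N, (P * P'), (Q * Q') => z z1.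
have [h1 h2] := h _ z1; have [h1' h2'] := h' _ z1.
by rewrite !hornerE -h1 -h2 -h1' -h2' conjcM !exprD; split; ring.
Qed.

(** Clearing denominators, P - c X^N has infinitely many roots, hence is zero. *)
Lemma laurent_eq_cst f (u : nat -> C) c : laurent f -> injective u ->
  (forall n, u n * (u n)^*%C = 1 /\ f (u n) = c) ->
  forall z, z * z^*%C = 1 -> f z = c.
Proof.
move=> [N [P [Q h]]] uinj hu z z1.
have P0 : P - c *: 'X^N = 0.
  apply/eqP/negPn/negP => p0; set p := P - _ in p0.
  pose rs := [seq u n | n <- iota 0 (size p)].
  have := max_poly_roots p0 (rs := rs).
  rewrite size_map size_iota ltnn map_inj_uniq// iota_uniq => /(_ _ isT) H.
  suff : false by [].
  apply: H; apply/allP => _ /mapP[n _ ->].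
  have [u1 fu] := hu n; have [h1 _] := h _ u1.
  by rewrite /root /p !hornerE -h1 fu subrr.
have [h1 _] := h _ z1.
have z0 : z ^+ N != 0.
  by rewrite expf_neq0//; apply: contra_eq_neq z1 => ->; rewrite mul0r eq_sym oner_eq0.
apply: (mulIf z0); rewrite h1; apply/eqP; rewrite -subr_eq0.
by have := congr1 (fun q => q.[z]) P0; rewrite !hornerE => ->.
Qed.

(** Real and imaginary parts are combinations of a function and its conjugate; this is why [laurent]
    constrains both. *)
Lemma laurent_polyfun (m : C -> SU2 R) (phi : SU2 R -> R) : polyfun phi ->
  laurent (fun z => alpha (m z)) -> laurent (fun z => beta (m z)) ->
  laurent (fun z => (phi (m z))%:C).
Proof.
move=> pphi la lb.
have lRe f : laurent f -> laurent (fun z => (complex.Re (f z))%:C).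
  move=> lf; under eq_fun do rewrite ReJ_add.
  by apply: laurentM (laurent_cst _); apply: laurentD (laurent_conj _).
have lIm f : laurent f -> laurent (fun z => (complex.Im (f z))%:C).
  move=> lf; under eq_fun do rewrite ImJ_sub -mulrA -mulN1r.
  apply: laurentM (laurent_cst _); apply: laurentD; first exact: laurent_conj.
  by apply: laurentM => //; exact: laurent_cst.
elim: pphi => [c|k|f g _ lf _ lg|f g _ lf _ lg].
- exact: laurent_cst.
- by rewrite /qc /qcn; case: k => [[|[|[|k]]] lt] /=; [exact: lRe|exact: lIm|exact: lRe|exact: lIm].
- by under eq_fun do rewrite rmorphD; exact: laurentD.
- by under eq_fun do rewrite rmorphM; exact: laurentM.
Qed.

Lemma laurent_mulr h (m : C -> SU2 R) :
  laurent (fun z => alpha (m z)) -> laurent (fun z => beta (m z)) ->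
  laurent (fun z => alpha (h * m z)%g) /\ laurent (fun z => beta (h * m z)%g).
Proof.
move=> la lb; split.
  under eq_fun do rewrite alphaM -mulN1r.
  apply: laurentD; first by apply: laurentM => //; exact: laurent_cst.
  apply: laurentM; first exact: laurent_cst.
  by apply: laurentM; [exact: laurent_cst|exact: laurent_conj].
under eq_fun do rewrite betaM.
apply: laurentD; first by apply: laurentM => //; exact: laurent_cst.
by apply: laurentM; [exact: laurent_cst|exact: laurent_conj].
Qed.

Lemma laurent_ext f g : (forall z, z * z^*%C = 1 -> f z = g z) -> laurent f -> laurent g.
Proof.
move=> fg [N [P [Q h]]]; exists N, P, Q => z z1; rewrite -fg//; exact: h.
Qed.

Lemma polar c : exists r z, [/\ 0 <= r, z * z^*%C = 1 & c = r%:C * z].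
Proof.
have [->|c0] := eqVneq c 0.
  by exists 0, 1; rewrite mul0r mul1r conjc1.
exists (complex.Re `|c|), (c / `|c|).
have nc : (complex.Re `|c|)%:C = `|c|.
  by apply/eqP; rewrite normc_def eq_complex /= !eqxx.
have nc0 : `|c| != 0 by rewrite normr_eq0.
split; first by rewrite normc_def /= sqrtr_ge0.
  rewrite conjcM mulrACA -sqr_normc conjc_inv -{2}nc conjc_real nc expr2.
  by field.
by rewrite nc mulrC divfK.
Qed.

Lemma circle_sqrt c : c * c^*%C = 1 -> exists z, z * z^*%C = 1 /\ z * z = c.
Proof.
move=> c1; exists (sqrtC c); rewrite -expr2 sqrtCK; split => //.
rewrite -sqr_normc -normrX sqrtCK; apply/eqP.
by rewrite -(@eqrXn2 _ 2)// expr1n sqr_normc c1.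
Qed.

End laurent.

(** * Stabilizers of polynomials under right translation *)

Section generation.
Variable R : realType.
Local Notation C := R[i].
Implicit Types (x y g h t : SU2 R) (phi : SU2 R -> R).

Lemma polyfun_mulr phi (s : SU2 R) : polyfun phi -> polyfun (fun h => phi (h * s)%g).
Proof.
elim=> [c|k|f g _ pf _ pg|f g _ pf _ pg]; first exact: polyfun_cst.
- under eq_fun do rewrite qcM; apply: polyfun_sum => l.
  apply: polyfunM; last exact: polyfun_cst.
  apply: polyfunZ.
  have [j ->] := @qcn_qc R (lmx_index k l).2; exact: polyfun_qc.
- exact: polyfunD.
- exact: polyfunM.
Qed.

Lemma diag_param : exists m : C -> SU2 R,
  forall z, z * z^*%C = 1 -> alpha (m z) = z /\ beta (m z) = 0.
Proof.
have /choice[m hm] (z : C) : exists x, z * z^*%C = 1 -> alpha x = z /\ beta x = 0.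
  have [z1|z1] := pselect (z * z^*%C = 1); last by exists 1%g.
  have [|x hx] := @mkSU2P R z 0; last by exists x.
  by rewrite mul0r addr0.
by exists m.
Qed.

Lemma rot_param : exists m : C -> SU2 R, forall z, z * z^*%C = 1 ->
  alpha (m z) = (complex.Re z)%:C /\ beta (m z) = (complex.Im z)%:C.
Proof.
have /choice[m hm] (z : C) : exists x, z * z^*%C = 1 ->
    alpha x = (complex.Re z)%:C /\ beta x = (complex.Im z)%:C.
  have [z1|z1] := pselect (z * z^*%C = 1); last by exists 1%g.
  have [|x hx] := @mkSU2P R (complex.Re z)%:C (complex.Im z)%:C; last by exists x.
  move: z1; rewrite !conjc_real; case: z => a b /= /eqP; rewrite eq_complex /= => /andP[/eqP h _].
  by apply/eqP; rewrite eq_complex /=; apply/andP; split; apply/eqP; [rewrite -h|]; ring.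
by exists m.
Qed.

(** Euler angles: diagonal factors on both sides remove the phases of alpha and beta. The last
    clause allows distinct rotations to be recognized from [beta g] alone. *)
Lemma euler g : exists t1 t2 r s, [/\ beta t1 = 0, beta t2 = 0,
  alpha (t1 * g * t2)%g = r%:C, beta (t1 * g * t2)%g = s%:C
  & 0 <= s /\ (s ^+ 2)%:C = beta g * (beta g)^*%C].
Proof.
have [r [a [r0 a1 ga]]] := polar (alpha g).
have [s [b [s0 b1 gb]]] := polar (beta g).
(* With diagonal factors v and (a v)^-1 the phase of alpha cancels and beta is multiplied by a v^2,
   which must be the inverse of b. *)
have [v [v1 vv]] : exists v : C, v * v^*%C = 1 /\ v * v = a^*%C * b^*%C.
  apply: circle_sqrt; rewrite conjcM !conjcK mulrACA (mulrC _ a) a1 (mulrC _ b) b1.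
  by rewrite mulr1.
have [m hm] := diag_param.
have [am bm] := hm _ v1.
have w1 : (a^*%C * v^*%C) * (a^*%C * v^*%C)^*%C = 1.
  by rewrite conjcM !conjcK mulrACA (mulrC _ a) a1 (mulrC _ v) v1 mulr1.
have [aw bw] := hm _ w1.
exists (m v), (m (a^*%C * v^*%C)), r, s; split => //.
- rewrite alphaM bw conjc0 mulr0 subr0 aw alphaM am bm mul0r subr0 ga.
  rewrite -[RHS]mulr1 -[in RHS]a1 -[RHS]mulr1 -[in RHS]v1; ring.
- rewrite betaM bw mulr0 add0r aw betaM am bm mul0r addr0 gb conjcM !conjcK.
  transitivity (s%:C * b * a * (v * v)); first by ring.
  rewrite vv -[RHS]mulr1 -[in RHS]a1 -[RHS]mulr1 -[in RHS]b1; ring.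
- split => //; rewrite gb conjcM conjc_real mulrACA b1 mulr1.
  by rewrite -rmorphM expr2.
Qed.

Section invariance.
Variable phi : SU2 R -> R.
Hypothesis pphi : polyfun phi.
Let H g := forall h, phi (h * g)%g = phi h.

Lemma stabM g1 g2 : H g1 -> H g2 -> H (g1 * g2)%g.
Proof. by move=> h1 h2 h; rewrite mulgA h2 h1. Qed.

Lemma stabV g : H g -> H g^-1%g.
Proof. by move=> hg h; rewrite -[LHS]hg mulgVK. Qed.

(* Infinitely many points of the circle are dense for Laurent polynomials. *)
Lemma stab_family (m : C -> SU2 R) (u : nat -> C) :
  laurent (fun z => alpha (m z)) -> laurent (fun z => beta (m z)) ->
  injective u -> (forall n, u n * (u n)^*%C = 1 /\ H (m (u n))) ->
  forall z, z * z^*%C = 1 -> H (m z).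
Proof.
move=> la lb uinj hu z z1 h.
have [la' lb'] := laurent_mulr h la lb.
have lf := laurent_polyfun pphi la' lb'.
suff [] : (phi (h * m z)%g)%:C = (phi h)%:C by [].
apply: (laurent_eq_cst lf uinj) => // n; have [u1 Hu] := hu n.
by split => //; rewrite Hu.
Qed.

(** The powers of D have pairwise distinct [alpha], so they supply the infinitely many points of the
    circle that [stab_family] asks for. *)
Lemma stab_diagonal D : beta D = 0 -> (forall n, (D ^+ n.+1)%g <> 1%g) -> H D ->
  forall t, beta t = 0 -> H t.
Proof.
move=> bD tor HD t bt.
have [m hm] := diag_param.
have a1 x : beta x = 0 -> alpha x * (alpha x)^*%C = 1.
  by move=> bx; have := SU2_norm x; rewrite bx mul0r addr0.
have bDn n : beta (D ^+ n)%g = 0.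
  elim: n => [|n ih]; first by rewrite expg0 beta1.
  by rewrite expgS betaM bD ih mulr0 mul0r addr0.
have mE x : beta x = 0 -> m (alpha x) = x.
  move=> bx; have [e1 e2] := hm _ (a1 _ bx).
  by apply: SU2_ext; rewrite ?e1 ?e2 ?bx.
rewrite -(mE _ bt).
apply: (@stab_family m (fun n => alpha (D ^+ n)%g)) (a1 _ bt).
- by apply: laurent_ext (laurent_id _) => z /hm[].
- by apply: laurent_ext (laurent_cst 0) => z /hm[].
- have main i j : (i < j)%N -> alpha (D ^+ i)%g <> alpha (D ^+ j)%g.
    move=> ij aij; apply: (tor (j - i).-1); rewrite prednK ?subn_gt0//.
    have : (D ^+ i = D ^+ j)%g by apply: SU2_ext; rewrite ?bDn.
    rewrite -{1}(subnK (ltnW ij)) expgnDr => e; apply: (@mulIg _ (D ^+ i)%g).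
    by rewrite -e mul1g.
  move=> i j aij; have [ij|ij|//] := ltngtP i j; first by case: (main _ _ ij).
  by case: (main _ _ ij).
- move=> n; split; first exact: a1.
  rewrite mE//; elim: n => [|n ih] h; first by rewrite expg0 mulg1.
  by rewrite expgS; exact: stabM.
Qed.

(* The elements [y t y^-1], [t] diagonal, yield infinitely many distinct
   rotations up to diagonal factors, hence all rotations, and diagonals and
   rotations generate by [euler]. *)
Lemma stab_all y : (forall t, beta t = 0 -> H t) -> H y ->
  alpha y != 0 -> beta y != 0 -> forall g, H g.
Proof.
move=> HT Hy ay by0.
have [t [c tc]] := diag_seq R.
pose g n := (y * t n * y^-1)%g.
have Hg n : H (g n).
  by apply: stabM; [apply: stabM => //; apply: HT; case: (tc n)|exact: stabV].
have /choice[rs hrs] n : exists rs : R * R, [/\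
    exists t1 t2, [/\ beta t1 = 0, beta t2 = 0,
    alpha (t1 * g n * t2)%g = rs.1%:C & beta (t1 * g n * t2)%g = rs.2%:C],
    0 <= rs.2 & (rs.2 ^+ 2)%:C = beta (g n) * (beta (g n))^*%C].
  have [t1 [t2 [r [s [h1 h2 h3 h4 [h5 h6]]]]]] := euler (g n).
  by exists (r, s); split => //; exists t1, t2.
have [m hm] := rot_param.
have Hrot : forall z, z * z^*%C = 1 -> H (m z).
  apply: (@stab_family m (fun n => (rs n).1 +i* (rs n).2)).
  - apply: laurent_ext (_ : laurent (fun z => (z + z^*%C) * 2^-1)).
      by move=> z /hm[-> _]; rewrite ReJ_add.
    apply: laurentM (laurent_cst _); apply: laurentD; first exact: laurent_id.
    exact: laurent_conj (laurent_id _).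
  - apply: laurent_ext (_ : laurent (fun z => (z^*%C + (-1) * z) * (2^-1 * 'i%C))).
      by move=> z /hm[_ ->]; rewrite ImJ_sub mulrA mulN1r.
    apply: laurentM (laurent_cst _); apply: laurentD; first exact: laurent_conj (laurent_id _).
    by apply: laurentM (laurent_id _); exact: laurent_cst.
  (* Here s_n^2 = |beta (g n)|^2 = 4 |alpha y beta y|^2 (1 - c_n^2) and c_n^2 = 1/(1+n^2), so s_n
     determines n. *)
  - move=> i j [_ sij].
    have c2 n : c n ^+ 2 * (1 + n%:R ^+ 2) = 1.
      have := SU2_norm (t n); have [_ -> ->] := tc n.
      rewrite mul0r addr0 => /eqP; rewrite eq_complex /= => /andP[/eqP e _].
      by rewrite -[RHS]e; ring.
    pose N := complex.Re (alpha y * beta y * (alpha y * beta y)^*%C).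
    have N0 : N != 0.
      rewrite /N -sqr_normc normc_def -rmorphXn /= expf_neq0//.
      have : alpha y * beta y != 0 by rewrite mulf_neq0.
      by rewrite -normr_eq0 normc_def eq_complex /= eqxx andbT.
    have s2 n : (rs n).2 ^+ 2 = N * (4 * (1 - c n ^+ 2)).
      have [_ _ e] := hrs n; have [_ ta tb] := tc n.
      have -> : 1 - c n ^+ 2 = (n%:R * c n) ^+ 2 by rewrite -[X in X - _](c2 n); ring.
      suff : ((rs n).2 ^+ 2)%:C = (alpha y * beta y * (alpha y * beta y)^*%C) *
          (4 * (n%:R * c n) ^+ 2)%:C.
        rewrite /N; move: (alpha y * beta y * (alpha y * beta y)^*%C) => [a b].
        by move=> /(congr1 (@complex.Re R)) /= ->; rewrite mulr0 subr0.
      rewrite e /g !betaM !alphaM betaV alphaV tb conjc0 !mulr0 add0r subr0 conjcK ta.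
      have -> : alpha y * ((1 +i* n%:R) * (c n)%:C) * - beta y +
          beta y * ((1 +i* n%:R) * (c n)%:C)^*%C * alpha y =
        alpha y * beta y * (((1 +i* n%:R) * (c n)%:C)^*%C - (1 +i* n%:R) * (c n)%:C).
        by ring.
      have AB (A B : C) : (A * B) * (A * B)^*%C = (A * A^*%C) * (B * B^*%C).
        by rewrite conjcM mulrACA.
      rewrite [LHS]AB; congr (_ * _).
      by apply/eqP; rewrite eq_complex /=; apply/andP; split; apply/eqP; ring.
    have := s2 i; rewrite sij s2 => /(mulfI N0) h.
    have cij : c i ^+ 2 = c j ^+ 2 by lra.
    have ci0 : c i ^+ 2 != 0 by rewrite expf_neq0// gt_eqF//; case: (tc i).
    have : c i ^+ 2 * (1 + i%:R ^+ 2) = c i ^+ 2 * (1 + j%:R ^+ 2).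
      by rewrite c2 cij c2.
    move=> /(mulfI ci0) /(@addrI R) /eqP; rewrite eqrXn2// ?ler0n// eqr_nat => /eqP//.
  - move=> n; have [[t1 [t2 [b1 b2 ra rb]]] _ _] := hrs n.
    have u1 : ((rs n).1 +i* (rs n).2) * ((rs n).1 +i* (rs n).2)^*%C = 1.
      have := SU2_norm (t1 * g n * t2)%g; rewrite ra rb !conjc_real => /eqP.
      rewrite eq_complex /= => /andP[/eqP h _]; apply/eqP; rewrite eq_complex /=.
      by apply/andP; split; apply/eqP; [rewrite -h|]; ring.
    split => //.
    have [e1 e2] := hm _ u1.
    have -> : m ((rs n).1 +i* (rs n).2) = (t1 * g n * t2)%g.
      by apply: SU2_ext; rewrite ?e1 ?e2 ?ra ?rb.
    by do !apply: stabM => //; exact: HT.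
move=> x; have [t1 [t2 [r [s [b1 b2 xa xb _]]]]] := euler x.
have u1 : (r +i* s) * (r +i* s)^*%C = 1.
  have := SU2_norm (t1 * x * t2)%g; rewrite xa xb !conjc_real => /eqP.
  rewrite eq_complex /= => /andP[/eqP h _]; apply/eqP; rewrite eq_complex /=.
  by apply/andP; split; apply/eqP; [rewrite -h|]; ring.
have [e1 e2] := hm _ u1.
have -> : (x = t1^-1 * m (r +i* s) * t2^-1)%g.
  have -> : m (r +i* s) = (t1 * x * t2)%g by apply: SU2_ext; rewrite ?e1 ?e2 ?xa ?xb.
  by rewrite !mulgA mulVg mul1g mulgK.
by do !apply: stabM; [exact/stabV/HT|exact: Hrot|exact/stabV/HT].
Qed.

End invariance.

(** Once x is conjugated to a diagonal D, and y to z, the clauses of [good] read: D has infinite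
    order, beta z is nonzero, alpha z is nonzero. These are the hypotheses of [stab_diagonal] and
    [stab_all]. *)
Lemma good_invariant phi x y : polyfun phi -> good x y ->
  (forall h, phi (h * x)%g = phi h) -> (forall h, phi (h * y)%g = phi h) ->
  forall h, phi h = phi 1%g.
Proof.
move=> pphi [tor xy yxy] phix phiy.
have [s sx] := SU2_diagonal x.
have [D xD {}sx] : exists2 D, (x = s * D * s^-1)%g & beta D = 0.
  by exists (s^-1 * x * s)%g => //; rewrite !mulgA mulgV mul1g mulgK.
have [z yz] : exists z, (y = s * z * s^-1)%g.
  by exists (s^-1 * y * s)%g; rewrite !mulgA mulgV mul1g mulgK.
pose psi h := phi (h * s^-1)%g.
have ppsi : polyfun psi by exact: polyfun_mulr.
have psiD h : psi (h * D)%g = psi h.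
  by rewrite /psi -[RHS]phix xD !mulgA mulgVK.
have psiz h : psi (h * z)%g = psi h.
  by rewrite /psi -[RHS]phiy yz !mulgA mulgVK.
have torD n : (D ^+ n.+1)%g <> 1%g.
  have DX m : (x ^+ m = s * D ^+ m * s^-1)%g.
    elim: m => [|m ih]; first by rewrite !expg0 mulg1 mulgV.
    by rewrite !expgS ih xD !mulgA mulgVK.
  by move=> Dn; apply: (tor n); rewrite DX Dn mulg1 mulgV.
have az : alpha z != 0.
  apply: contra_notN yxy => /eqP az; rewrite xD yz !invgM !invgK !mulgA !mulgVK.
  congr (_ * _)%g; rewrite -!mulgA; congr (_ * _)%g; rewrite mulgA.
  apply: (@mulIg _ z); rewrite mulgVK; apply: SU2_ext.
    by rewrite !alphaM alphaV betaV sx az conjc0; ring.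
  by rewrite !betaM alphaV betaV sx az; ring.
have bz : beta z != 0.
  apply: contra_notN xy => /eqP bz; rewrite xD yz !mulgA !mulgVK.
  congr (_ * _)%g; rewrite -!mulgA; congr (_ * _)%g; apply: SU2_ext.
    by rewrite !alphaM sx bz conjc0; ring.
  by rewrite !betaM sx bz; ring.
have all_H := stab_all ppsi (stab_diagonal ppsi sx torD psiD) psiz az bz.
move=> h; have := all_H (h * s)%g 1%g; have := all_H s 1%g.
by rewrite /psi !mul1g mulgV mulgK => -> ->.
Qed.

End generation.

(** * Invariant sets have measure 0 or 1 *)

Section integration.
Variables (R : realType) (mu : probability (SU2 R) R).
Hypothesis haar : left_invariant mu.
Implicit Types (g h x y : SU2 R).

Lemma haar_ge0_integral g (f : SU2 R -> \bar R) : measurable_fun setT f ->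
  (forall x, 0 <= f x)%E -> (\int[mu]_x f (g * x)%g = \int[mu]_x f x)%E.
Proof.
move=> mf f0.
have mg : measurable_fun setT (fun x => (g * x)%g) by exact: measurable_mulg.
have := ge0_integral_pushforward mg mu measurableT mf (fun x _ => f0 x).
rewrite preimage_setT => <-; apply: eq_measure_integral => A mA _.
exact: haar.
Qed.

Lemma haar_integral g (f : SU2 R -> \bar R) : measurable_fun setT f ->
  (\int[mu]_x f (g * x)%g = \int[mu]_x f x)%E.
Proof.
move=> mf; rewrite [LHS]integralE [RHS]integralE.
have hp := haar_ge0_integral g (measurable_funepos mf) (funepos_ge0 f).
have hn := haar_ge0_integral g (measurable_funeneg mf) (funeneg_ge0 f).
by rewrite -hp -hn; congr (_ - _)%E; apply: eq_integral => x _; rewrite ?funeposE ?funenegE.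
Qed.

Lemma haar_Rintegral g (f : SU2 R -> R) : measurable_fun setT f ->
  Rintegral mu setT (fun x => f (g * x)%g) = Rintegral mu setT f.
Proof.
move=> mf; rewrite /Rintegral; congr fine.
by apply: (haar_integral g (f := EFin \o f)); exact/measurable_EFinP.
Qed.

Lemma haar_integrable g (f : SU2 R -> R) : mu.-integrable setT (EFin \o f) ->
  mu.-integrable setT (EFin \o (fun x => f (g * x)%g)).
Proof.
move=> /integrableP[/measurable_EFinP mf foo]; apply/integrableP; split.
  apply/measurable_EFinP; apply: measurableT_comp => //; exact: measurable_mulg.
rewrite /= (haar_integral g (f := fun x => `|(f x)%:E|%E))//.
by apply/measurable_EFinP; exact: measurableT_comp.
Qed.

(** Separation of variables: integrating p(h x) in x against any weight leaves a polynomial in h. *)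
Lemma polyfun_mulE (p : SU2 R -> R) : polyfun p ->
  exists (I : finType) (A B : I -> SU2 R -> R),
    [/\ forall i, polyfun (A i), forall i, polyfun (B i) &
    forall h x, p (h * x)%g = \sum_i A i h * B i x].
Proof.
elim=> [c|k|f g _ [I [A [B [pA pB AB]]]] _ [J [A' [B' [pA' pB' AB']]]]|
            f g _ [I [A [B [pA pB AB]]]] _ [J [A' [B' [pA' pB' AB']]]]].
- exists 'I_1, (fun _ _ => c), (fun _ _ => 1); split.
  + by move=> _; exact: polyfun_cst.
  + by move=> _; exact: polyfun_cst.
  + by move=> h x; rewrite big_ord1 mulr1.
- exists 'I_4, (fun l h => lmx h k l), (fun l => qc l); split.
  + move=> l; apply: polyfunZ; have [j ->] := qcn_qc R (lmx_index k l).2.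
    exact: polyfun_qc.
  + by move=> l; exact: polyfun_qc.
  + by move=> h x; rewrite qcM.
- exists (I + J)%type, (fun i => match i with inl i => A i | inr j => A' j end),
    (fun i => match i with inl i => B i | inr j => B' j end); split.
  + by case.
  + by case.
  + by move=> h x; rewrite big_sumType/= AB AB'.
- exists (I * J)%type, (fun i h => A i.1 h * A' i.2 h), (fun i h => B i.1 h * B' i.2 h).
  split.
  + by move=> i; exact: polyfunM.
  + by move=> i; exact: polyfunM.
  + move=> h x; rewrite AB AB' mulr_suml -(pair_bigA _ (fun i j =>
      A i h * A' j h * (B i x * B' j x)))/=; apply: eq_bigr => i _.
    by rewrite mulr_sumr; apply: eq_bigr => j _; rewrite mulrACA.
Qed.

Lemma indic_integrable (F : set (SU2 R)) : measurable F ->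
  mu.-integrable setT (EFin \o (\1_F : SU2 R -> R)).
Proof.
move=> mF; apply: bounded_integrable; first exact: measurable_indic.
by exists 1 => x; rewrite indicE; case: (_ \in _); rewrite ?normr1 ?normr0.
Qed.

(** As a function of h the left side is a polynomial. Substituting in the integral shows it
    invariant under right translation by x and y, because F and [mu] are invariant on the left; so
    it is constant. *)
Lemma invariant_moment_cst (F : set (SU2 R)) x y (p : SU2 R -> R) : measurable F ->
  good x y -> (forall g, F (x * g)%g <-> F g) -> (forall g, F (y * g)%g <-> F g) ->
  polyfun p -> forall h,
  Rintegral mu setT (fun g => \1_F g * p (h * g)%g) = Rintegral mu setT (fun g => \1_F g * p g).
Proof.
move=> mF xy Fx Fy pp.
pose phi h := Rintegral mu setT (fun g => \1_F g * p (h * g)%g).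
have [I [A [B [pA pB AB]]]] := polyfun_mulE pp.
have iB i : mu.-integrable setT (EFin \o (fun g => \1_F g * B i g)).
  by apply: integrableM_polyfun => //; exact: indic_integrable.
have pphi : polyfun phi.
  have -> : phi = fun h => \sum_i A i h * Rintegral mu setT (fun g => \1_F g * B i g).
    apply/funext => h; rewrite /phi /Rintegral.
    transitivity (fine (\int[mu]_g (\sum_i ((A i h)%:E * (\1_F g * B i g)%:E)))%E).
      congr fine; apply: eq_integral => g _; rewrite AB mulr_sumr -sumEFin.
      by apply: eq_bigr => i _; rewrite -EFinM; congr _%:E; ring.
    rewrite integral_sum//=; last by move=> i; exact: integrableZl (iB i).
    rewrite -sum_fine//; last first.
      by move=> i _; apply: integrable_fin_num => //; exact: integrableZl (iB i).
    apply: eq_bigr => i _; rewrite integralZl//=; last exact: iB.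
    by rewrite fineM//=; apply: integrable_fin_num => //; exact: iB.
  by apply: polyfun_sum => i; apply: polyfunM => //; exact: polyfun_cst.
have phi_inv z : (forall g, F (z * g)%g <-> F g) -> forall h, phi (h * z)%g = phi h.
  move=> Fz h; rewrite /phi -[RHS](haar_Rintegral z); last first.
    apply: measurable_funM; first exact: measurable_indic.
    apply: (measurableT_comp (polyfun_measurable pp)); exact: measurable_mulg.
  apply: eq_Rintegral => g _; rewrite mulgA; congr (_ * _).
  rewrite !indicE; congr (_ %:R : R); congr nat_of_bool.
  by apply/idP/idP; rewrite !inE => /Fz.
move=> h; have := good_invariant pphi xy (phi_inv _ Fx) (phi_inv _ Fy) h.
by rewrite /phi => ->; apply: eq_Rintegral => g _; rewrite mul1g.
Qed.

(** F and its translates have the same moments, so they agree almost everywhere. Tonelli on the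
    pairs with g in F and h g outside F then gives mu(F) mu(~F) = 0, the sections at fixed g being
    right translates of the complement. *)
Lemma invariant_set_01 (F : set (SU2 R)) x y : measurable F -> good x y ->
  (forall g, F (x * g)%g <-> F g) -> (forall g, F (y * g)%g <-> F g) ->
  mu F = 0%E \/ mu F = 1%E.
Proof.
move=> mF xy Fx Fy.
have mFh h : measurable ((fun x => (h * x)%g) @^-1` F).
  by apply: measurable_preimage => //; exact: measurable_mulg.
have null h : mu (F `&` (fun x => (h * x)%g) @^-1` (~` F)) = 0%E.
  pose f := (fun x => \1_F x - \1_((fun x => (h * x)%g) @^-1` F) x) : SU2 R -> R.
  have iF : mu.-integrable setT (EFin \o (\1_F : SU2 R -> R)) by exact: indic_integrable.
  have iFh : mu.-integrable setT (EFin \o (\1_((fun x => (h * x)%g) @^-1` F) : SU2 R -> R)).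
    exact: indic_integrable.
  have fi : mu.-integrable setT (EFin \o f).
    by have := integrableB measurableT iF iFh; apply: eq_integrable => // z _ /=.
  have f0 w : Rintegral mu setT (fun x => f x * mono w x) = 0.
    have pw := polyfun_mono R w.
    transitivity (Rintegral mu setT (fun x => \1_F x * mono w x) -
       Rintegral mu setT (fun x => \1_((fun x => (h * x)%g) @^-1` F) x * mono w x)).
      rewrite -RintegralB//; try exact: integrableM_polyfun.
      by apply: eq_Rintegral => z _; rewrite mulrBl.
    apply/eqP; rewrite subr_eq0; apply/eqP/esym.
    rewrite -(invariant_moment_cst mF xy Fx Fy pw h^-1%g).
    rewrite -[RHS](haar_Rintegral h); last first.
      apply: measurable_funM; first exact: measurable_indic.
      apply: (measurableT_comp (polyfun_measurable pw)); exact: measurable_mulg.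
    by apply: eq_Rintegral => z _; rewrite mulKg.
  have [N [mN N0 sN]] := moments0_ae_eq0 fi f0.
  apply: (subset_measure0 _ mN) N0.
    by apply: measurableI => //; rewrite preimage_setC; exact: measurableC (mFh h).
  move=> z [Fz nFz]; apply: sN => /= /(_ Logic.I) /eqP.
  rewrite /f !indicE (mem_set Fz) memNset// subr0.
  by rewrite eqe oner_eq0.
pose E := [set p : SU2 R * SU2 R | F p.2 /\ ~ F (p.1 * p.2)%g].
have mE : measurable E.
  have -> : E = (fun p : SU2 R * SU2 R => p.2) @^-1` F `&`
      (fun p : SU2 R * SU2 R => (p.1 * p.2)%g) @^-1` (~` F) by [].
  apply: measurableI; apply: measurable_preimage => //; first exact: measurable_snd.
    by apply: measurable_mulg; [exact: measurable_fst|exact: measurable_snd].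
  exact: measurableC.
have := integral_sections mu mu mE.
rewrite (eq_integral (fun=> 0%E)); last by move=> h _; exact: null.
rewrite integral0 => /esym.
have cfin : mu (~` F) \is a fin_num by rewrite fin_num_measure//; exact: measurableC.
rewrite (eq_integral (fun g => (fine (mu (~` F)))%:E * (\1_F g)%:E)%E); last first.
  move=> g _; rewrite fineK//; rewrite indicE; have [Fg|nFg] := boolP (g \in F).
    rewrite mule1 -[RHS](haar_mulr haar g (measurableC mF)); congr (mu _).
    by apply/seteqP; split=> z /=; rewrite /E /=; [case|split => //; move: Fg; rewrite inE].
  rewrite mule0 -[RHS](measure0 mu); congr (mu _); apply/seteqP; split=> z //= [Fg _].
  by move: nFg; rewrite notin_setE.
rewrite integralZl//=; last exact: indic_integrable.
rewrite fineK// integral_indic// setIT => /eqP; rewrite mule_eq0 => /orP[/eqP h|/eqP]; last by left.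
right; have := probability_setC mu mF; rewrite h => /esym/eqP.
have Ffin : mu F \is a fin_num by rewrite fin_num_measure.
by rewrite -(fineK Ffin) -EFinB !eqe subr_eq0 => /eqP <-.
Qed.

End integration.

(** * A zero-one law for product measures *)

Section tuples.
Context d (T : measurableType d) (R : realType).
Implicit Types (n : nat).

Definition updt n (j : 'I_n) (y : T) (x : n.-tuple T) : n.-tuple T :=
  [tuple if i == j then y else tnth x i | i < n].

Lemma tnth_updt n (j i : 'I_n) y x :
  tnth (updt j y x) i = if i == j then y else tnth x i.
Proof. by rewrite tnth_mktuple. Qed.

Lemma measurable_updt n (j : 'I_n) :
  measurable_fun setT (fun p : T * n.-tuple T => updt j p.1 p.2).
Proof.
apply/measurable_fun_tnthP => i.
rewrite (_ : _ \o _ = fun p : T * n.-tuple T => if i == j then p.1 else tnth p.2 i); last first.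
  by apply/funext => p /=; rewrite tnth_updt.
case: eqP => _; first exact: measurable_fst.
exact: (measurableT_comp (measurable_tnth i) measurable_snd).
Qed.

Lemma measurable_updt1 n (j : 'I_n) x : measurable_fun setT (fun y => updt j y x).
Proof.
have mp : measurable_fun setT (fun y : T => (y, x)).
  by apply: measurable_fun_pair => //; exact: measurable_cst.
exact: (measurableT_comp (measurable_updt j) mp).
Qed.

Definition boxes n : set (set (n.-tuple T)) :=
  [set B | exists2 A : 'I_n -> set T, forall i, measurable (A i) &
     B = [set x | forall i, A i (tnth x i)]].

Lemma measurable_box n (A : 'I_n -> set T) : (forall i, measurable (A i)) ->
  measurable [set x : n.-tuple T | forall i, A i (tnth x i)].
Proof.
move=> mA.
rewrite (_ : mkset _ = \bigcap_(i in [set: 'I_n]) ((fun x => tnth x i) @^-1` A i)).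
  apply: fin_bigcap_measurable; first exact: finite_finset.
  by move=> i _; rewrite -[X in measurable X]setTI; exact: measurable_tnth.
by apply/seteqP; split=> x /= h i; [move=> _|]; exact: h.
Qed.

Lemma measurable_boxes n : measurable = <<s @boxes n >>.
Proof.
apply/seteqP; split; last first.
  apply: smallest_sub; first exact: sigma_algebra_measurable.
  by move=> _ [A mA ->]; exact: measurable_box.
apply: smallest_sub; first exact: smallest_sigma_algebra.
move=> B; rewrite -bigcup_seq => -[i _ [A mA <-]]; apply: sub_sigma_algebra.
exists (fun k => if k == i then A else setT); first by move=> k; case: ifP.
apply/seteqP; split=> x /=.
  by move=> [_ Ax] k; case: eqP => // ->.
by move=> /(_ i); rewrite eqxx.
Qed.

Lemma measure_eq_boxes n (m1 m2 : {measure set (n.-tuple T) -> \bar R}) :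
  (m1 setT < +oo)%E -> (forall B, boxes B -> m1 B = m2 B) ->
  forall B, measurable B -> m1 B = m2 B.
Proof.
move=> m1oo m12 B mB.
apply: (@measure_unique _ _ _ (@boxes n) (fun=> setT) (@measurable_boxes n)) => //.
- move=> _ _ [A mA ->] [A' mA' ->]; exists (fun i => A i `&` A' i).
    by move=> i; exact: measurableI.
  by apply/seteqP; split=> x /= => [[h1 h2] i|h]; [split|split=> i; case: (h i)].
- by move=> _; exists (fun=> setT) => //; apply/seteqP; split.
- by rewrite bigcup_const//; exists 0.
Qed.

Variable P : probability T R.
Local Notation Q := (power_prob P _).

(** Replacing one coordinate by an independent copy preserves the product measure; it is enough to
    compare on boxes. *)
Lemma resample n (j : 'I_n) (A : set (n.-tuple T)) : measurable A ->
  (\int[power_prob P n]_x P [set y | A (updt j y x)] = power_prob P n A)%E.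
Proof.
move=> mA.
have mE B : measurable B -> measurable ((fun p => updt j p.1 p.2) @^-1` B).
  by move=> mB; rewrite -[X in measurable X]setTI; exact: measurable_updt.
have := integral_sections P (power_prob P n) (mE _ mA).
move=> <-.
transitivity (pushforward (P \x power_prob P n)%E (fun p => updt j p.1 p.2) A).
  rewrite /pushforward /product_measure1; apply: eq_integral => y _.
  by rewrite /= xsectionE.
have mu1 : measurable_fun setT (fun p : T * n.-tuple T => updt j p.1 p.2).
  exact: measurable_updt.
apply: (@measure_eq_boxes n (pushforward (P \x power_prob P n)%E (fun p => updt j p.1 p.2))
  (power_prob P n)) => //.
  apply: (@le_lt_trans _ _ 1%E); last exact: ltry.
  exact: (probability_le1 (P \x power_prob P n)%E measurableT).
move=> _ [B mB ->]; rewrite [RHS](power_probE P mB) /= /pushforward.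
pose B' i := if i == j then setT else B i.
rewrite (_ : _ @^-1` _ = B j `*` [set x | forall i, B' i (tnth x i)]).
  have mB' i : measurable (B' i) by rewrite /B'; case: ifP.
  rewrite product_measure1E//; last exact: measurable_box.
  transitivity (P (B j) * \prod_(i < n) P (B' i))%E.
    by congr (_ * _)%E; exact: power_probE.
  rewrite (bigD1 j)//= [in RHS](bigD1 j)//= /B' eqxx probability_setT mul1e.
  by congr (_ * _)%E; apply: eq_bigr => i /negbTE ->.
apply/seteqP; split=> -[y x] /=.
  move=> h; split; first by have := h j; rewrite tnth_updt eqxx.
  move=> i; rewrite /B'; case: ifPn => // ij.
  by have := h i; rewrite tnth_updt (negbTE ij).
move=> [By h] i; rewrite tnth_updt; case: eqP => [->//|/eqP ij].
by have := h i; rewrite /B' (negbTE ij).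
Qed.

Section zero_one.
Variables (n : nat) (A : set (n.-tuple T)).
Hypothesis mA : measurable A.
Hypothesis A01 : forall j : 'I_n, {ae power_prob P n, forall x,
  P [set y | A (updt j y x)] = 0%E \/ P [set y | A (updt j y x)] = 1%E}.

Lemma measurable_section j x (B : set (n.-tuple T)) : measurable B ->
  measurable [set y | B (updt j y x)].
Proof.
move=> mB; rewrite (_ : mkset _ = (fun y => updt j y x) @^-1` B)//.
by rewrite -[X in measurable X]setTI; exact: measurable_updt1.
Qed.

(** A section of A in coordinate j has measure 0 or 1, so intersecting it with B multiplies its
    measure by P B in either case, and D does not see coordinate j. *)
Lemma coord_indep (j : 'I_n) (B : set T) (D : set (n.-tuple T)) :
  measurable B -> measurable D -> (forall y x, D (updt j y x) <-> D x) ->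
  power_prob P n (A `&` [set x | B (tnth x j)] `&` D) =
  (P B * power_prob P n (A `&` D))%E.
Proof.
move=> mB mD Dj.
have mBj : measurable [set x : n.-tuple T | B (tnth x j)].
  rewrite (_ : mkset _ = (fun x => tnth x j) @^-1` B)//.
  by rewrite -[X in measurable X]setTI; exact: measurable_tnth.
have mAD : measurable (A `&` D) by exact: measurableI.
have mABD : measurable (A `&` [set x | B (tnth x j)] `&` D).
  by apply: measurableI => //; exact: measurableI.
have mf (E : set (n.-tuple T)) : measurable E ->
    measurable_fun setT (fun x => P [set y | E (updt j y x)]).
  move=> mE; pose E' := (fun p : T * n.-tuple T => updt j p.1 p.2) @^-1` E.
  have mE' : measurable E'.
    by rewrite -[X in measurable X]setTI; exact: measurable_updt.
  rewrite (_ : (fun x => _) = P \o ysection E'); first exact: measurable_fun_ysection.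
  by apply/funext => x /=; rewrite ysectionE.
rewrite -(resample j mABD) -(resample j mAD).
have Pfin : P B \is a fin_num by rewrite fin_num_measure.
rewrite -ge0_integralZl//; last exact: mf.
apply: ae_eq_integral => //; first exact: mf.
  by apply: measurable_funeM; exact: mf.
have := A01 j; apply: filterS => x h _ /=.
have [Dx|nDx] := pselect (D x); last first.
  rewrite [X in P X](_ : _ = set0); last first.
    by apply/seteqP; split=> y //= [_ /Dj].
  rewrite [X in (_ * P X)%E](_ : _ = set0); last first.
    by apply/seteqP; split=> y //= [_ /Dj].
  by rewrite measure0 mule0.
rewrite [X in P X](_ : _ = [set y | A (updt j y x)] `&` B); last first.
  apply/seteqP; split=> y /=; rewrite tnth_updt eqxx; first by move=> [[]].
  by move=> [Ay By]; split => //; exact/Dj.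
rewrite [X in (_ * P X)%E](_ : _ = [set y | A (updt j y x)]); last first.
  by apply/seteqP; split=> y /= => [[]//|Ay]; split => //; exact/Dj.
have mAx := measurable_section j x mA.
case: h => h.
  rewrite h mule0; apply: (subset_measure0 _ mAx) h => //.
  exact: measurableI.
rewrite h mule1.
have PC : P (~` [set y | A (updt j y x)]) = 0%E by rewrite probability_setC// h subee.
rewrite -[in RHS](setIT B) -(setUv [set y | A (updt j y x)]) setIUr measureU0.
- by rewrite setIC.
- exact: measurableI.
- by apply: measurableI => //; exact: measurableC.
- apply: (@subset_measure0 _ _ _ P _ (~` [set y | A (updt j y x)])) => //.
    by apply: measurableI => //; exact: measurableC.
  exact: measurableC.
Qed.

(** Coordinates are constrained one at a time; the set D of earlier constraints does not involve the
    current coordinate. *)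
Lemma box_indep (B : 'I_n -> set T) : (forall i, measurable (B i)) ->
  power_prob P n (A `&` [set x | forall i, B i (tnth x i)]) =
  (power_prob P n A * power_prob P n [set x | forall i, B i (tnth x i)])%E.
Proof.
move=> mB; rewrite power_probE//.
have main k : (k <= n)%N -> power_prob P n (A `&` [set x | forall i : 'I_n, (i < k)%N -> B i (tnth x i)]) =
    (power_prob P n A * \prod_(i < n | (i < k)%N) P (B i))%E.
  elim: k => [_|k ih kn].
    rewrite big_pred0 ?mule1//; congr (power_prob P n _).
    by apply/seteqP; split=> x /= => [[]|].
  pose D := [set x : n.-tuple T | forall i : 'I_n, (i < k)%N -> B i (tnth x i)].
  pose j := Ordinal kn.
  have mD : measurable D.
    rewrite (_ : D = [set x : n.-tuple T | forall i : 'I_n, (if (i < k)%N then B i else setT) (tnth x i)]).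
      by apply: (@measurable_box n (fun i => if (i < k)%N then B i else setT)) => i; case: ifP.
    by apply/seteqP; split=> x /= h i; have := h i; case: ifP => // _; apply.
  rewrite (_ : A `&` _ = A `&` [set x | B j (tnth x j)] `&` D).
    rewrite coord_indep//.
      transitivity (P (B j) * (power_prob P n A * \prod_(i < n | (i < k)%N) P (B i)))%E.
        by congr (_ * _)%E; exact: ih (ltnW kn).
      rewrite [in RHS](bigD1 j)//= muleCA; congr (_ * (_ * _))%E.
      by apply: eq_bigl => i; rewrite ltnS ltn_neqAle andbC -val_eqE.
    move=> y x; split=> h i ik; have := h i ik; rewrite tnth_updt -val_eqE /= ltn_eqF//.
  apply/seteqP; split=> x /=.
    by move=> [Ax h]; split; [split => //; exact: h|move=> i ik; apply: h; exact: ltnW].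
  move=> [[Ax Bx] h]; split => // i; rewrite ltnS leq_eqVlt => /orP[/eqP ik|/h//].
  by rewrite (_ : i = j)//; exact: val_inj.
have := main n (leqnn n).
rewrite (eq_bigl xpredT) => [<-|i]; last by rewrite ltn_ord.
by congr (power_prob P n _); apply/seteqP; split=> x /= [Ax h]; split=> // i *; apply: h.
Qed.

(** Independence of A from boxes extends to all measurable sets, in particular to A itself, so its
    measure equals its square. *)
Lemma zero_one : power_prob P n A = 0%E \/ power_prob P n A = 1%E.
Proof.
have Afin : power_prob P n A \is a fin_num by rewrite fin_num_measure.
have c0 : 0 <= fine (power_prob P n A) by exact: fine_ge0.
have h : mrestr (power_prob P n) mA A = mscale (NngNum c0) (power_prob P n) A.
  apply: measure_eq_boxes => //.
    by rewrite /= /mrestr setTI -ge0_fin_numE.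
  move=> _ [B mB ->]; rewrite /= /mrestr /mscale /= setIC fineK//.
  exact: box_indep.
move: h; rewrite /mrestr /mscale /= setIid.
 rewrite -(fineK Afin) -EFinM => -[h].
have : fine (power_prob P n A) * (fine (power_prob P n A) - 1) = 0.
  by rewrite mulrBr mulr1 -h subrr.
by move=> /eqP; rewrite mulf_eq0 subr_eq0 => /orP[] /eqP ->; [left|right].
Qed.

End zero_one.
End tuples.

(** * Generalized eigenvalue problems *)

Section generalized_eigenvalue.
Local Open Scope sesquilinear_scope.
Variables (C : numClosedFieldType) (n : nat).
Implicit Types (A B G S : 'M[C]_n) (v : 'rV[C]_n) (f g : C -> C).

Lemma adjmxM m p q (A : 'M[C]_(m, p)) (B : 'M[C]_(p, q)) :
  (A *m B)^t* = B^t* *m A^t*.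
Proof. by rewrite trmx_mul map_mxM. Qed.

Lemma hermitian_spectral A : A^t* = A ->
  exists (P : 'M[C]_n) (d : 'rV[C]_n), [/\ P *m P^t* = 1%:M, P^t* *m P = 1%:M,
    forall j, d 0 j \is Num.real & A = P^t* *m diag_mx d *m P].
Proof.
move=> AA; have hA : A \is hermsymmx.
  by apply/is_hermitianmxP; rewrite expr0 scale1r AA.
exists (spectralmx A), (spectral_diag A).
have /unitarymxP PP := spectral_unitarymx A.
split => //; first exact: mulmx1C.
  by move=> j; have /mxOverP := hermitian_spectral_diag_real hA.
have /hermitian_normalmx /orthomx_spectralP := hA.
by rewrite invmx_unitary ?spectral_unitarymx.
Qed.

Lemma rayleigh A v (c : C) : A^t* = A -> c \is Num.real ->
  c * (v *m v^t*) 0 0 < (v *m A *m v^t*) 0 0 ->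
  exists (e : C) (w : 'rV[C]_n), [/\ e \is Num.real, c < e, w != 0 & w *m A = e *: w].
Proof.
move=> AA cr lt; have [P [d [PP PP' dr AE]]] := hermitian_spectral AA.
pose x := v *m P^t*.
have xx : (v *m v^t*) 0 0 = \sum_j `|x 0 j| ^+ 2.
  have -> : v *m v^t* = x *m x^t*.
    by rewrite /x adjmxM trmxCK mulmxA -(mulmxA v) PP' mulmx1.
  by rewrite mxE; apply: eq_bigr => j _; rewrite !mxE normCK.
have xAx : (v *m A *m v^t*) 0 0 = \sum_j d 0 j * `|x 0 j| ^+ 2.
  have -> : v *m A *m v^t* = x *m diag_mx d *m x^t*.
    by rewrite AE /x adjmxM trmxCK !mulmxA.
  rewrite mxE; apply: eq_bigr => j _; rewrite mul_mx_diag !mxE normCK.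
  by rewrite mulrAC mulrC.
have [j cj] : exists j, c < d 0 j.
  apply: contrapT => /forallNP h.
  have : (v *m A *m v^t*) 0 0 <= c * (v *m v^t*) 0 0.
    rewrite xx xAx mulr_sumr; apply: ler_sum => j _.
    apply: ler_wpM2r; first by rewrite exprn_ge0.
    by rewrite real_leNgt ?dr//; apply/negP; exact: h.
  by move=> /(lt_le_trans lt); rewrite ltxx.
exists (d 0 j), (row j P); split => //.
- apply/eqP => /(congr1 (fun w => w *m P^t*)); rewrite mul0mx -row_mul PP.
  by move=> /rowP/(_ j); rewrite !mxE eqxx => /eqP; rewrite oner_eq0.
- rewrite -row_mul AE !mulmxA PP mul1mx row_mul.
  by rewrite row_diag_mx -scalemxAl -rowE.
Qed.

(** G may be singular. The kernel condition confines S to the range of G, where G has an inverse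
    square root; c >= 0 makes the eigenvalue nonzero, which forces its eigenvector into that
    range. *)
Lemma generalized_eigenvalue G S v (c : C) : G^t* = G -> S^t* = S ->
  (forall w : 'rV[C]_n, 0 <= (w *m G *m w^t*) 0 0) -> (forall w : 'rV[C]_n, w *m G = 0 -> w *m S = 0) ->
  0 <= c -> c * (v *m G *m v^t*) 0 0 < (v *m S *m v^t*) 0 0 ->
  exists (e : C) (w : 'rV[C]_n), [/\ e \is Num.real, c < e, w *m S = e *: (w *m G) & w *m G != 0].
Proof.
move=> GG SS G0 GS c0 lt.
have [P [d [PP PP' dr GE]]] := hermitian_spectral GG.
have d0 j : 0 <= d 0 j.
  have := G0 (row j P); rewrite -row_mul GE !mulmxA PP mul1mx row_mul.
  rewrite row_diag_mx -scalemxAl -rowE -scalemxAl mxE.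
  have -> : (row j P *m (row j P)^t*) 0 0 = 1.
    transitivity ((P *m P^t*) j j); last by rewrite PP mxE eqxx.
    by rewrite !mxE; apply: eq_bigr => k _; rewrite !mxE.
  by rewrite mulr1.
pose D f := P^t* *m diag_mx (map_mx f d) *m P.
have DM f g : D f *m D g = D (fun x => f x * g x).
  rewrite /D !mulmxA -(mulmxA _ P) PP mulmx1 -!mulmxA; congr (_ *m _).
  rewrite !mulmxA mulmx_diag; congr (diag_mx _ *m _).
  by apply/rowP => j; rewrite !mxE.
have Dext f g : (forall j, f (d 0 j) = g (d 0 j)) -> D f = D g.
  by move=> fg; congr (_ *m diag_mx _ *m _); apply/rowP => j; rewrite !mxE.
have DH f : (forall j, f (d 0 j) \is Num.real) -> (D f)^t* = D f.
  move=> fr; rewrite /D !adjmxM trmxCK mulmxA; congr (_ *m _ *m _).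
  apply/matrixP => i j; rewrite !mxE; case: (eqVneq j i) => [->|ji].
    by rewrite !mulr1n; apply/CrealP; exact: fr.
  by rewrite !mulr0n conjC0.
have GD : G = D id by rewrite GE; congr (_ *m diag_mx _ *m _); apply/rowP => j; rewrite !mxE.
(* [L] is the square root of [G], [K] the pseudo-inverse of [L] and [Pi] the
   projection onto their range; [K *m S *m K] has the wanted eigenvalues. *)
pose L := D sqrtC; pose K := D (fun x => (sqrtC x)^-1); pose Pi := D (fun x => (x != 0)%:R).
have LL : L *m L = G by rewrite GD DM; apply: Dext => j; rewrite -expr2 sqrtCK.
have sK x : sqrtC x * (sqrtC x)^-1 = (x != 0)%:R.
  have [->|x0] := eqVneq x 0; first by rewrite sqrtC0 mul0r.
  by rewrite divff// sqrtC_eq0.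
have LK : L *m K = Pi by rewrite DM; apply: Dext => j; rewrite sK.
have KL : K *m L = Pi by rewrite DM; apply: Dext => j; rewrite mulrC sK.
have PiL : Pi *m L = L.
  rewrite DM; apply: Dext => j; have [->|] := eqVneq (d 0 j) 0; first by rewrite sqrtC0 mulr0.
  by rewrite mul1r.
have KPi : K *m Pi = K.
  rewrite DM; apply: Dext => j; have [->|] := eqVneq (d 0 j) 0; first by rewrite sqrtC0 invr0 mul0r.
  by rewrite mulr1.
have sr j : sqrtC (d 0 j) \is Num.real by rewrite ger0_real// sqrtC_ge0.
have LH : L^t* = L by apply: DH.
have KH : K^t* = K by apply: DH => j; rewrite realV.
have PiH : Pi^t* = Pi by apply: DH => j; exact: realn.
have PiS : Pi *m S = S.
  pose Z := D (fun x => (x == 0)%:R).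
  have Z1 : Z + Pi = 1%:M.
    rewrite /Z /Pi /D -mulmxDl -mulmxDr -linearD /= -[RHS]PP' -[in RHS](mulmx1 (P^t*)).
    congr (_ *m _ *m _); rewrite -diag_const_mx; congr diag_mx.
    by apply/rowP => j; rewrite !mxE; case: eqP; rewrite ?addr0 ?add0r.
  have ZS : Z *m S = 0.
    apply/row_matrixP => i; rewrite row_mul row0; apply: GS.
    rewrite -row_mul GD DM; apply/rowP => k; rewrite (_ : D _ = 0) ?mxE//.
    rewrite /D (_ : map_mx _ d = 0) ?linear0 ?mulmx0 ?mul0mx//.
    by apply/rowP => j; rewrite !mxE; case: eqP => [->|_]; rewrite ?mulr0 ?mul0r.
  by rewrite -[RHS]mul1mx -Z1 mulmxDl ZS add0r.
have SPi : S *m Pi = S by rewrite -[in RHS]SS -[in RHS]PiS adjmxM SS PiH.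
clearbody L K Pi.
pose H := K *m S *m K.
have HH : H^t* = H by rewrite /H !adjmxM KH SS mulmxA.
have [||e [w [er ce w0 wH]]] := @rayleigh H (v *m L) c HH; first exact: ger0_real.
  rewrite adjmxM LH /H !mulmxA -(mulmxA v L K) LK -(mulmxA v Pi S) PiS.
  by rewrite -(mulmxA _ K L) KL -(mulmxA v S Pi) SPi -(mulmxA v L L) LL.
have e0 : e != 0 by rewrite gt_eqF// (le_lt_trans c0).
have wPi : w *m Pi = w.
  apply: (scalerI e0); rewrite scalemxAl -wH /H -!mulmxA KPi //.
have wG : w *m K *m G = w *m L.
  by rewrite -LL mulmxA -(mulmxA w K L) KL wPi.
exists e, (w *m K); split => //.
  rewrite wG scalemxAl -wH /H -[in LHS]SPi -KL; rewrite !mulmxA //.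
rewrite wG; apply: contra w0 => /eqP wL0.
by rewrite -wPi -LK mulmxA wL0 mul0mx.
Qed.

End generalized_eigenvalue.

Section real_generalized_eigenvalue.
Local Open Scope sesquilinear_scope.
Variables (R : rcfType) (n : nat).
Local Notation rc := (map_mx (real_complex R)).
Implicit Types (x y : 'rV[R]_n) (G S : 'M[R]_n).

Lemma rV_ReIm (w : 'rV[R[i]]_n) : w = rc (map_mx (@complex.Re R) w) +
  'i%C *: rc (map_mx (@complex.Im R) w).
Proof. by apply/rowP => j; rewrite !mxE -complexE. Qed.

Lemma rc_ReIm_inj x y x' y' : rc x + 'i%C *: rc y = rc x' + 'i%C *: rc y' ->
  x = x' /\ y = y'.
Proof.
move=> /rowP h; split; apply/rowP => j; have := h j; rewrite !mxE => /eqP;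
  rewrite eq_complex /= !mul0r !mul1r !subr0 !addr0 !add0r => /andP[/eqP h1 /eqP h2].
  by [].
by [].
Qed.

Lemma rc_form G x y : G^T = G ->
  ((rc x + 'i%C *: rc y) *m rc G *m (rc x + 'i%C *: rc y)^t*) 0 0 =
  ((x *m G *m x^T) 0 0 + (y *m G *m y^T) 0 0)%:C%C.
Proof.
move=> GG.
have -> : (rc x + 'i%C *: rc y)^t* = rc x^T - 'i%C *: rc y^T.
  apply/colP => j; rewrite !mxE; apply/eqP; rewrite eq_complex /=.
  by apply/andP; split; apply/eqP; ring.
have sym : x *m G *m y^T = y *m G *m x^T.
  have tr11 (M : 'M[R]_1) : M^T = M by apply/matrixP => i j; rewrite !ord1 mxE.
  by rewrite -(tr11 (y *m G *m x^T)) !trmx_mul trmxK GG mulmxA.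
have -> : (rc x + 'i%C *: rc y) *m rc G *m (rc x^T - 'i%C *: rc y^T) =
   rc (x *m G *m x^T + y *m G *m y^T).
  rewrite !mulmxDl !mulmxDr -!scalemxAl !mulmxN -!scalemxAr.
  rewrite -!map_mxM sym map_mxD scalerN scalerA.
  have -> : ('i%C * 'i%C : R[i]) = -1 by apply/eqP; rewrite eq_complex /=; apply/andP; split; apply/eqP; ring.
  by rewrite scaleN1r opprK addrA subrK.
by rewrite !mxE.
Qed.

(** The complex solution has a real eigenvalue, so its real and imaginary parts both solve the real
    problem, and at least one is outside the kernel of G. *)
Lemma generalized_eigenvalue_real G S x (c : R) : G^T = G -> S^T = S ->
  (forall w : 'rV[R]_n, 0 <= (w *m G *m w^T) 0 0) ->
  (forall w : 'rV[R]_n, w *m G = 0 -> w *m S = 0) ->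
  0 <= c -> c * (x *m G *m x^T) 0 0 < (x *m S *m x^T) 0 0 ->
  exists (e : R) (w : 'rV[R]_n), [/\ c < e, w *m S = e *: (w *m G) & w *m G != 0].
Proof.
move=> GG SS G0 GS c0 lt.
have adjrc A : A^T = A -> (rc A)^t* = rc A.
  move=> AA; rewrite map_trmx -[in RHS]AA; apply/matrixP => i j; rewrite !mxE.
  exact: conjc_real.
have rcM (w : 'rV[R[i]]_n) A : w *m rc A = rc (map_mx (@complex.Re R) w *m A) +
    'i%C *: rc (map_mx (@complex.Im R) w *m A).
  by rewrite {1}[w]rV_ReIm mulmxDl -scalemxAl !map_mxM.
have xform A : A^T = A -> (rc x *m rc A *m (rc x)^t*) 0 0 = ((x *m A *m x^T) 0 0)%:C%C.
  move=> AA; have := @rc_form A x 0 AA.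
  by rewrite map_mx0 scaler0 addr0 !mul0mx => ->; rewrite [X in _ + X]mxE addr0.
have [||||e [w [er ce wS wG]]] := @generalized_eigenvalue R[i] n (rc G) (rc S) (rc x) (c%:C%C)
    (adjrc _ _ GG) (adjrc _ _ SS).
- move=> w; rewrite {1 2}[w]rV_ReIm rc_form// lecR addr_ge0//; exact: G0.
- move=> w; rewrite !rcM -[X in _ = X -> _]addr0 -[X in _ = _ + X -> _](scaler0 _ 'i%C).
  rewrite -(map_mx0 (real_complex R)) => /rc_ReIm_inj[h1 h2].
  by rewrite (GS _ h1) (GS _ h2) map_mx0 scaler0 addr0.
- by rewrite lecR.
- by rewrite !xform// -rmorphM ltcR.
have eE : e = (complex.Re e)%:C%C.
  by rewrite RRe_real.
have ce' : c < complex.Re e by move: ce; rewrite eE ltcR.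
have [xS yS] : map_mx (@complex.Re R) w *m S = complex.Re e *: (map_mx (@complex.Re R) w *m G) /\
    map_mx (@complex.Im R) w *m S = complex.Re e *: (map_mx (@complex.Im R) w *m G).
  apply: rc_ReIm_inj; rewrite -!rcM wS rcM {1}eE scalerDr.
  by rewrite !map_mxZ !scalerA mulrC.
have [xG|xG] := eqVneq (map_mx (@complex.Re R) w *m G) 0; last first.
  by exists (complex.Re e), (map_mx (@complex.Re R) w).
exists (complex.Re e), (map_mx (@complex.Im R) w); split => //.
apply: contra_neq wG => yG; rewrite rcM xG yG.
by rewrite map_mx0 scaler0 addr0.
Qed.

End real_generalized_eigenvalue.

(** * Energies and almost invariant tuples *)

Section Rintegral_lincomb.
Context d (T : measurableType d) (R : realType) (mu : {measure set T -> \bar R}).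
Variables (I : finType) (c : I -> R) (F : I -> T -> R).
Hypothesis iF : forall i, mu.-integrable setT (EFin \o F i).

Let lincombE : EFin \o (fun x => \sum_i c i * F i x) =
  fun x => (\sum_i (c i)%:E * (F i x)%:E)%E.
Proof. by apply/funext => x /=; rewrite -sumEFin. Qed.

Lemma Rintegral_lincomb : Rintegral mu setT (fun x => \sum_i c i * F i x) =
  \sum_i c i * Rintegral mu setT (F i).
Proof.
rewrite /Rintegral -[X in fine (integral _ _ X)]/(EFin \o _) lincombE.
have iZ i : mu.-integrable setT (fun x => (c i)%:E * (F i x)%:E)%E.
  exact: (integrableZl measurableT (c i) (iF i)).
rewrite integral_sum// -sum_fine//; last first.
  by move=> i _; exact: integrable_fin_num (iZ i).
apply: eq_bigr => i _; rewrite (integralZl measurableT (iF i)) fineM//.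
exact: integrable_fin_num (iF i).
Qed.

End Rintegral_lincomb.

(** * Real inner product and translation energy *)

Section inner_product.
Variables (R : realType) (mu : probability (SU2 R) R).
Hypothesis haar : left_invariant mu.
Implicit Types (g h x : SU2 R) (f k : SU2 R -> R).

Definition sqint f := measurable_fun setT f /\
  mu.-integrable setT (EFin \o (fun x => f x ^+ 2)).

Definition ip f k : R := Rintegral mu setT (fun x => f x * k x).

Lemma sqintM f k : sqint f -> sqint k ->
  mu.-integrable setT (EFin \o (fun x => f x * k x)).
Proof.
move=> [mf f2] [mk k2].
have fk2 := integrableD measurableT f2 k2.
apply: (le_integrable measurableT) fk2.
  by apply/measurable_EFinP; exact: measurable_funM.
move=> x _ /=; rewrite lee_fin [leRHS]ger0_norm; last first.
  by rewrite addr_ge0 ?sqr_ge0.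
rewrite ler_norml; have := sqr_ge0 (f x + k x); have := sqr_ge0 (f x - k x).
by have := sqr_ge0 (f x); have := sqr_ge0 (k x); rewrite !expr2 => *; apply/andP; split; nra.
Qed.

Lemma sqint_polyfun f : polyfun f -> sqint f.
Proof.
move=> pf; split; first exact: polyfun_measurable.
by apply: polyfun_integrable; exact: polyfunX.
Qed.

Lemma sqint_integrable f : sqint f -> mu.-integrable setT (EFin \o f).
Proof.
move=> sf; have := sqintM sf (sqint_polyfun (polyfun_cst 1)).
by apply: eq_integrable => // x _ /=; rewrite mulr1.
Qed.

Lemma sqint_translate g f : sqint f -> sqint (fun x => f (g * x)%g).
Proof.
move=> [mf f2]; split; last exact: (haar_integrable haar g f2).
by apply: measurableT_comp => //; exact: measurable_mulg.
Qed.

Lemma sqintD f k : sqint f -> sqint k -> sqint (fun x => f x + k x).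
Proof.
move=> sf sk; split; first by apply: measurable_funD; [case: sf|case: sk].
have := integrableD measurableT (integrableD measurableT sf.2 sk.2)
  (integrableZl measurableT 2 (sqintM sf sk)).
by apply: eq_integrable => // x _ /=; rewrite -!EFinM -!EFinD; congr _%:E; ring.
Qed.

Lemma sqintZ c f : sqint f -> sqint (fun x => c * f x).
Proof.
move=> [mf f2]; split; first exact: measurable_funM.
have := integrableZl measurableT (c ^+ 2) f2.
by apply: eq_integrable => // x _ /=; rewrite -EFinM exprMn.
Qed.

Lemma sqintB f k : sqint f -> sqint k -> sqint (fun x => f x - k x).
Proof.
move=> sf sk; have := sqintD sf (sqintZ (-1) sk).
by congr sqint; apply/funext => x; rewrite mulN1r.
Qed.

Lemma sqint_sum (I : finType) (F : I -> SU2 R -> R) :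
  (forall i, sqint (F i)) -> sqint (fun x => \sum_i F i x).
Proof.
move=> sF; elim: (index_enum I) => [|i s ih].
  under eq_fun do rewrite big_nil; exact: sqint_polyfun (polyfun_cst 0).
by under eq_fun do rewrite big_cons; exact: sqintD.
Qed.

Lemma ipC f k : ip f k = ip k f.
Proof. by apply: eq_Rintegral => x _; rewrite mulrC. Qed.

Lemma ip_suml (I : finType) (c : I -> R) (F : I -> SU2 R -> R) k :
  (forall i, sqint (F i)) -> sqint k ->
  ip (fun x => \sum_i c i * F i x) k = \sum_i c i * ip (F i) k.
Proof.
move=> sF sk; rewrite -(Rintegral_lincomb c (fun i => sqintM (sF i) sk)).
apply: eq_Rintegral => x _; rewrite mulr_suml.
by apply: eq_bigr => i _; rewrite mulrA.
Qed.

Lemma ipDl f1 f2 k : sqint f1 -> sqint f2 -> sqint k ->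
  ip (fun x => f1 x + f2 x) k = ip f1 k + ip f2 k.
Proof.
move=> s1 s2 sk; rewrite -RintegralD//; try exact: sqintM.
by apply: eq_Rintegral => x _; rewrite mulrDl.
Qed.

Lemma ipZl c f k : sqint f -> sqint k -> ip (fun x => c * f x) k = c * ip f k.
Proof.
move=> sf sk; rewrite -RintegralZl//; last exact: sqintM.
by apply: eq_Rintegral => x _; rewrite mulrA.
Qed.

Lemma ipBl f1 f2 k : sqint f1 -> sqint f2 -> sqint k ->
  ip (fun x => f1 x - f2 x) k = ip f1 k - ip f2 k.
Proof.
move=> s1 s2 sk; rewrite -RintegralB//; try exact: sqintM.
by apply: eq_Rintegral => x _; rewrite mulrBl.
Qed.

Lemma ip_ge0 f : 0 <= ip f f.
Proof. by apply: Rintegral_ge0 => x _; rewrite -expr2 sqr_ge0. Qed.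

Lemma ip_eq0 f : sqint f -> ip f f = 0 -> f = cst 0 %[ae mu].
Proof.
move=> sf f0; have mf := sf.1.
have f2' : (\int[mu]_x `|(f x ^+ 2)%:E| = 0)%E.
  rewrite -[RHS]/(0%:E) -f0 /ip /Rintegral fineK//.
    by apply: eq_integral => x _ /=; rewrite ger0_norm ?sqr_ge0// expr2.
  exact: (integrable_fin_num measurableT (sqintM sf sf)).
have /(ae_eq_integral_abs mu measurableT (f := fun x => (f x ^+ 2)%:E))[h _] :
  measurable_fun setT (fun x => (f x ^+ 2)%:E).
  by apply/measurable_EFinP; exact: measurable_funX.
have := h f2'; apply: filterS => x /= /(_ Logic.I) [] /eqP.
by rewrite sqrf_eq0 => /eqP ->.
Qed.

Lemma ip_ae_eq f1 f2 k : measurable_fun setT f1 -> measurable_fun setT f2 ->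
  measurable_fun setT k ->
  f1 = f2 %[ae mu] -> ip f1 k = ip f2 k.
Proof.
move=> m1 m2 mk h; rewrite /ip /Rintegral; congr fine.
apply: ae_eq_integral => //; try by apply/measurable_EFinP; exact: measurable_funM.
by apply: filterS h => x /= h _; rewrite h.
Qed.

Lemma ip_translate g f k : measurable_fun setT f -> measurable_fun setT k ->
  ip (fun x => f (g * x)%g) k = ip f (fun x => k (g^-1 * x)%g).
Proof.
move=> mf mk; rewrite /ip -[RHS](haar_Rintegral haar g); last first.
  by apply: measurable_funM => //; apply: measurableT_comp => //; exact: measurable_mulg.
by apply: eq_Rintegral => x _; rewrite mulKg.
Qed.

Definition energy g f := ip (fun x => f (g^-1 * x)%g - f x) (fun x => f (g^-1 * x)%g - f x).

Lemma energyE g f : sqint f ->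
  energy g f = 2 * ip f f - 2 * ip (fun x => f (g^-1 * x)%g) f.
Proof.
move=> sf; have sg := sqint_translate g^-1%g sf.
rewrite /energy ipBl//; last exact: sqintB.
rewrite [X in X - _]ipC [X in _ - X]ipC !ipBl//.
have -> : ip (fun x => f (g^-1 * x)%g) (fun x => f (g^-1 * x)%g) = ip f f.
  rewrite (ip_translate _ sf.1 sg.1); congr ip; apply/funext => x.
  by rewrite invgK mulKg.
by rewrite (ipC f (fun x => f (g^-1 * x)%g)); ring.
Qed.

Lemma energyV g f : sqint f -> energy g^-1%g f = energy g f.
Proof.
move=> sf; rewrite !energyE// invgK (ip_translate _ sf.1 sf.1).
by rewrite (ipC f (fun x => f (g^-1 * x)%g)).
Qed.

(** Pointwise (a - c)^2 <= 2(a - b)^2 + 2(b - c)^2 with b = f(g^-1 x); the first square is the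
    energy density of h translated by g^-1. *)
Lemma energyM g h f : sqint f -> energy (g * h)%g f <= 2 * energy g f + 2 * energy h f.
Proof.
move=> sf.
have s1 : sqint (fun x => f (g^-1 * x)%g - f x) by apply: sqintB => //; exact: sqint_translate.
have s2 : sqint (fun x => f (h^-1 * x)%g - f x) by apply: sqintB => //; exact: sqint_translate.
have s2g := sqint_translate g^-1%g s2.
have s3 : sqint (fun x => f ((g * h)^-1 * x)%g - f x) by apply: sqintB => //; exact: sqint_translate.
have -> : energy h f = ip (fun x => f (h^-1 * (g^-1 * x))%g - f (g^-1 * x)%g)
    (fun x => f (h^-1 * (g^-1 * x))%g - f (g^-1 * x)%g).
  by rewrite /energy /ip -[LHS](haar_Rintegral haar g^-1%g)//; exact: measurable_funM s2.1 s2.1.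
rewrite /energy /ip -!RintegralZl//; try exact: sqintM.
rewrite -RintegralD//; last 2 first.
- by have := integrableZl measurableT 2 (sqintM s1 s1); apply: eq_integrable.
- by have := integrableZl measurableT 2 (sqintM s2g s2g); apply: eq_integrable.
apply: le_Rintegral => //; first exact: sqintM.
  have := integrableD measurableT (integrableZl measurableT 2 (sqintM s1 s1))
    (integrableZl measurableT 2 (sqintM s2g s2g)).
  by apply: eq_integrable => // x _ /=; rewrite -!EFinM -!EFinD.
move=> x _; rewrite invgM -mulgA.
move: (f (h^-1 * _)%g) (f (g^-1 * x)%g) (f x) => a b c.
by have := sqr_ge0 (a - b - (b - c)); rewrite expr2; nra.
Qed.

End inner_product.

Section quadratic_int.
Variables (R : realType) (N : nat).

(** Rounding (K+1) a down and rescaling approximates a; positivity is an open condition and is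
    insensitive to the scale. *)
Lemma quadratic_pos_int (M : 'M[R]_N) (a : 'rV[R]_N) : 0 < (a *m M *m a^T) 0 0 ->
  exists b : 'rV[int]_N, 0 < (map_mx intr b *m M *m (map_mx intr b)^T : 'M[R]_1) 0 0.
Proof.
have qE (v : 'rV[R]_N) : (v *m M *m v^T) 0 0 = \sum_j (\sum_i v 0 i * M i j) * v 0 j.
  by rewrite !mxE; apply: eq_bigr => j _; rewrite !mxE.
move=> a0; pose b K : 'rV[int]_N := \row_i Num.floor (K.+1%:R * a 0 i).
pose v K : 'rV[R]_N := K.+1%:R^-1 *: map_mx intr (b K).
have va i : v K 0 i @[K --> \oo] --> a 0 i.
  apply/cvgrPdist_le => e e0.
  have := near_infty_natSinv_lt (PosNum e0); apply: filterS => K /= Ke.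
  rewrite !mxE; apply: le_trans (ltW Ke).
  set z := K.+1%:R * a 0 i.
  have K0 : 0 < K.+1%:R :> R by rewrite ltr0n.
  have -> : a 0 i = K.+1%:R^-1 * z by rewrite mulKf// gt_eqF.
  rewrite -mulrBr normrM gtr0_norm ?invr_gt0// ger_pMr ?invr_gt0//.
  rewrite ger0_norm ?subr_ge0 ?floor_le//.
  by rewrite lerBlDl ltW// -[X in _ + X]/(1%:~R) -rmorphD floorD1_gt.
have qv : (v K *m M *m (v K)^T) 0 0 @[K --> \oo] --> (a *m M *m a^T) 0 0.
  rewrite qE; under eq_cvg do rewrite qE.
  apply: cvg_big => [|j _]; first exact: add_continuous.
  apply: cvgM => //; apply: cvg_big => [|i _]; first exact: add_continuous.
  by apply: cvgM => //; exact: cvg_cst.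
have [K _ /(_ K (leqnn K)) vK] : \forall K \near \oo, 0 < (v K *m M *m (v K)^T) 0 0.
  exact: (cvgr_gt _ qv).
exists (b K); move: vK; rewrite /v -!scalemxAl linearZ /= -scalemxAr !mxE.
by rewrite !pmulr_rgt0 ?invr_gt0 ?ltr0n.
Qed.

End quadratic_int.

(** * Finite-dimensional spaces of centered monomials *)

Section families.
Variables (R : realType) (mu : probability (SU2 R) R).
Hypothesis haar : left_invariant mu.
Implicit Types (g h x : SU2 R).

(** Words instead of multi-indices: translation then acts by the d-th tensor power of [lmx], at the
    price of repeated functions. *)
Definition word d := {ffun 'I_d -> 'I_4}.
Definition wordf d (w : word d) x : R := \prod_i qc (w i) x.

Lemma mono_wordf (w : seq 'I_4) : @mono R w = wordf [ffun i : 'I_(size w) => nth ord0 w i].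
Proof.
apply/funext => x; rewrite /mono (big_nth ord0) big_mkord.
by apply: eq_bigr => i _; rewrite ffunE.
Qed.

Lemma polyfun_wordf d (w : word d) : polyfun (wordf w).
Proof. by apply: polyfun_prod => i; exact: polyfun_qc. Qed.

Definition word_rep d h (w w' : word d) : R := \prod_i lmx h (w i) (w' i).

Lemma wordfM d (w : word d) h x :
  wordf w (h * x)%g = \sum_(w' : word d) word_rep h w w' * wordf w' x.
Proof.
rewrite /wordf; under eq_bigr do rewrite qcM.
rewrite bigA_distr_bigA; apply: eq_bigr => w' _.
by rewrite big_split.
Qed.

Local Notation dim d := #|{: word d}|%N.

Definition fam d (i : 'I_(dim d)) x : R :=
  wordf (enum_val i) x - Rintegral mu setT (wordf (enum_val i)).
Definition rmx d h : 'M[R]_(dim d) :=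
  \matrix_(i, j) word_rep h (enum_val i) (enum_val j).

Lemma polyfun_fam d (i : 'I_(dim d)) : polyfun (fam i).
Proof. by apply: polyfunB; [exact: polyfun_wordf|exact: polyfun_cst]. Qed.

Lemma sqint_fam d (i : 'I_(dim d)) : sqint mu (fam i).
Proof. exact: sqint_polyfun (polyfun_fam i). Qed.

Lemma integrable_wordf d (w : word d) : mu.-integrable setT (EFin \o wordf w).
Proof. exact: polyfun_integrable (polyfun_wordf w). Qed.

Lemma fam_mean0 d (i : 'I_(dim d)) : Rintegral mu setT (fam i) = 0.
Proof.
rewrite /fam RintegralB//; [|exact: integrable_wordf|exact: polyfun_integrable (polyfun_cst _)].
rewrite Rintegral_cst// (_ : fine _ = 1) ?mulr1 ?subrr//.
by rewrite -[RHS]/(fine 1%E); congr fine; exact: probability_setT.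
Qed.

(** Means are translation invariant, so centering does not change the matrix of the action. *)
Lemma famM d (i : 'I_(dim d)) h x :
  fam i (h * x)%g = \sum_j rmx d h i j * fam j x.
Proof.
have reindexW (F : word d -> R) : \sum_w F w = \sum_(j < dim d) F (enum_val j).
  by rewrite (reindex (@enum_val _ {: word d}))//; exact/onW_bij/enum_val_bij.
have wM := @wordfM d (enum_val i) h.
have iM : Rintegral mu setT (wordf (enum_val i)) =
    \sum_(j < dim d) rmx d h i j * Rintegral mu setT (wordf (enum_val j)).
  rewrite -(haar_Rintegral haar h); last exact: polyfun_measurable (polyfun_wordf _).
  under eq_Rintegral do rewrite wM reindexW.
  rewrite (Rintegral_lincomb _ (fun j => integrable_wordf (enum_val j))).
  by apply: eq_bigr => j _; rewrite mxE.
rewrite /fam wM iM reindexW -sumrB; apply: eq_bigr => j _.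
by rewrite mxE mulrBr.
Qed.

Definition lc d (a : 'rV[R]_(dim d)) x : R := \sum_i a 0 i * fam i x.

Lemma polyfun_lc d (a : 'rV[R]_(dim d)) : polyfun (lc a).
Proof. by apply: polyfun_sum => i; apply: polyfunZ; exact: polyfun_fam. Qed.

Lemma sqint_lc d (a : 'rV[R]_(dim d)) : sqint mu (lc a).
Proof. exact: sqint_polyfun (polyfun_lc a). Qed.

Lemma lcM d (a : 'rV[R]_(dim d)) h x : lc a (h * x)%g = lc (a *m rmx d h) x.
Proof.
rewrite /lc; under eq_bigr do rewrite famM mulr_sumr.
rewrite exchange_big; apply: eq_bigr => j _; rewrite mxE mulr_suml.
by apply: eq_bigr => i _; rewrite mulrA.
Qed.

Definition gram d : 'M[R]_(dim d) := \matrix_(i, j) ip mu (fam i) (fam j).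

Lemma gram_sym d : (gram d)^T = gram d.
Proof. by apply/matrixP => i j; rewrite !mxE ipC. Qed.

Lemma ip_lc d (a b : 'rV[R]_(dim d)) : ip mu (lc a) (lc b) = (a *m gram d *m b^T) 0 0.
Proof.
rewrite ip_suml//; [|by move=> i; exact: sqint_fam|exact: sqint_lc].
rewrite -mulmxA mxE; apply: eq_bigr => i _; congr (_ * _).
rewrite ipC ip_suml//; [|by move=> j; exact: sqint_fam|exact: sqint_fam].
by rewrite mxE; apply: eq_bigr => j _; rewrite !mxE mulrC ipC.
Qed.

Section tuple.
Variable n : nat.
Implicit Type phi : n.-tuple (SU2 R).

Definition tau d phi : 'M[R]_(dim d) :=
  \sum_i (rmx d (tnth phi i)^-1%g + rmx d (tnth phi i)).

Definition total_energy phi f := \sum_i energy mu (tnth phi i) f.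

Lemma energy_lc d (a : 'rV[R]_(dim d)) g : energy mu g (lc a) =
  2 * (a *m gram d *m a^T) 0 0 -
  (a *m (rmx d g^-1%g + rmx d g) *m gram d *m a^T) 0 0.
Proof.
rewrite (energyE haar _ (sqint_lc a)) -ip_lc.
have hg h : ip mu (fun x => lc a (h * x)%g) (lc a) = (a *m rmx d h *m gram d *m a^T) 0 0.
  by rewrite -ip_lc; congr ip; apply/funext => x; rewrite lcM.
have e : ip mu (fun x => lc a (g * x)%g) (lc a) = ip mu (fun x => lc a (g^-1 * x)%g) (lc a).
  by rewrite (ip_translate haar _ (sqint_lc a).1 (sqint_lc a).1) ipC.
have -> : (a *m (rmx d g^-1%g + rmx d g) *m gram d *m a^T) 0 0 =
    (a *m rmx d g^-1%g *m gram d *m a^T) 0 0 + (a *m rmx d g *m gram d *m a^T) 0 0.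
  by rewrite mulmxDr !mulmxDl mxE.
by rewrite -!hg e; ring.
Qed.

(** Relative to |f|^2, the energy is 2n minus the Rayleigh quotient of the operator. *)
Lemma total_energy_lc d (a : 'rV[R]_(dim d)) phi : total_energy phi (lc a) =
  (2 * n)%:R * (a *m gram d *m a^T) 0 0 - (a *m tau d phi *m gram d *m a^T) 0 0.
Proof.
rewrite /total_energy; under eq_bigr do rewrite energy_lc.
rewrite sumrB sumr_const card_ord -mulrnAl -mulrnA; congr (_ - _).
rewrite /tau mulmx_sumr !mulmx_suml summxE; exact: eq_bigr.
Qed.

(** Energies are nonnegative, so the strict inequality already keeps [lc a] from vanishing almost
    everywhere. *)
Definition almost_invariant phi := forall k, exists d (a : 'rV[R]_(dim d)),
  k.+1%:R * total_energy phi (lc a) < ip mu (lc a) (lc a).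

(* Integer coefficients suffice by density and homogeneity, so that the
   condition is a countable one. *)
Lemma almost_invariantE : almost_invariant = \bigcap_k \bigcup_d
  \bigcup_(b : 'rV[int]_(dim d)) [set phi |
     k.+1%:R * total_energy phi (lc (map_mx intr b)) < ip mu (lc (map_mx intr b)) (lc (map_mx intr b))].
Proof.
apply/seteqP; split=> phi; last first.
  move=> h k; have [d _ [b _ /= hb]] := h k Logic.I.
  by exists d, (map_mx intr b).
move=> h k _; have [d [a ha]] := h k; exists d => //.
pose M := gram d - k.+1%:R *: ((2 * n)%:R *: gram d - tau d phi *m gram d).
have ME v : (v *m M *m v^T) 0 0 = ip mu (lc v) (lc v) - k.+1%:R * total_energy phi (lc v).
  rewrite total_energy_lc ip_lc /M mulmxBr mulmxBl -scalemxAr -scalemxAl mulmxBr mulmxBl.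
  by rewrite -scalemxAr -scalemxAl !mulmxA !mxE; ring.
have [|b hb] := @quadratic_pos_int R _ M a; first by rewrite ME subr_gt0.
by exists b => //=; rewrite -subr_gt0 -ME.
Qed.

Lemma measurable_energy_lc d (a : 'rV[R]_(dim d)) :
  measurable_fun setT (fun g => energy mu g (lc a)).
Proof.
have mr (f : SU2 R -> SU2 R) : measurable_fun setT f ->
    measurable_fun setT (fun g => (a *m rmx d (f g) *m gram d *m a^T) 0 0).
  move=> mf; under eq_fun do rewrite -mulmxA mxE.
  apply: measurable_sum => j; apply: measurable_funM => //.
  under eq_fun do rewrite mxE.
  apply: measurable_sum => i; apply: measurable_funM => //.
  under eq_fun do rewrite mxE.
  by apply: measurable_prod => k _; exact: measurable_lmx.
under eq_fun do rewrite energy_lc mulmxDr !mulmxDl [X in _ - X]mxE.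
apply: measurable_funB => //; apply: measurable_funD; last exact: (mr id).
by apply: mr; exact: measurable_invg.
Qed.

Lemma measurable_almost_invariant : measurable (almost_invariant : set _).
Proof.
rewrite almost_invariantE; apply: bigcapT_measurable => k.
apply: bigcupT_measurable => d.
apply: countable_bigcupT_measurable; first exact: countableP.
move=> b; set f := lc _.
have mE : measurable_fun setT (fun phi : n.-tuple (SU2 R) => k.+1%:R * total_energy phi f).
  apply: measurable_funM => //; apply: measurable_sum => i.
  exact: (measurableT_comp (measurable_energy_lc _) (measurable_tnth i)).
rewrite (_ : mkset _ = (fun phi => k.+1%:R * total_energy phi f) @^-1` `]-oo, (ip mu f f)[).
  by rewrite -[X in measurable X]setTI; exact: mE.
by apply/seteqP; split=> phi /=; rewrite in_itv.
Qed.

Lemma almost_invariant_le (c : nat) phi psi :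
  (forall d (a : 'rV[R]_(dim d)), total_energy psi (lc a) <= c%:R * total_energy phi (lc a)) ->
  almost_invariant phi -> almost_invariant psi.
Proof.
(* The factor c is absorbed by a larger index, since (k+1)c + 1 >= (k+1)c. *)
move=> le h k; have [d [a ha]] := h (k.+1 * c)%N; exists d, a.
apply: le_lt_trans ha; apply: (@le_trans _ _ (k.+1%:R * (c%:R * total_energy phi (lc a)))).
  by rewrite ler_wpM2l.
rewrite mulrA -natrM ler_wpM2r//; last by rewrite ler_nat.
by apply: sumr_ge0 => i _; exact: ip_ge0.
Qed.

(** As i differs from j, phi_i stays in the tuple and its energy is part of the total; [energyM]
    then controls the new entry, and phi_i^-1, of equal energy, undoes the move. *)
Lemma almost_invariant_mul (i j : 'I_n) y phi : i != j ->
  almost_invariant (updt j (tnth phi i * y)%g phi) <-> almost_invariant (updt j y phi).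
Proof.
move=> ij.
have main (g h : SU2 R) : g = tnth phi i \/ g = (tnth phi i)^-1%g ->
    almost_invariant (updt j h phi) -> almost_invariant (updt j (g * h)%g phi).
  (* At j the energy is at most 2E + 2E, elsewhere at most E. *)
  move=> gi; apply: (@almost_invariant_le (n * 4)) => d a.
  set E := total_energy (updt j h phi) (lc a).
  have e0 l : 0 <= energy mu (tnth (updt j h phi) l) (lc a) by exact: ip_ge0.
  have eE l : energy mu (tnth (updt j h phi) l) (lc a) <= E.
    by rewrite /E /total_energy (bigD1 l)//= lerDl sumr_ge0.
  have E0 : 0 <= E by exact: sumr_ge0.
  clearbody E.
  have gE : energy mu g (lc a) <= E.
    have := eE i; rewrite tnth_updt (negbTE ij) => h1.
    by case: gi => ->; [exact: h1|rewrite (energyV haar _ (sqint_lc a)); exact: h1].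
  apply: (@le_trans _ _ (\sum_(l < n) 4 * E)); last first.
    by rewrite sumr_const card_ord -mulrnAl -mulrnA mulnC.
  apply: ler_sum => l _; rewrite tnth_updt; case: eqP => [_|/eqP lj].
    move: gE (eE j) (energyM haar g h (sqint_lc a)); rewrite tnth_updt eqxx.
    move: (energy mu g (lc a)) (energy mu h (lc a)) (energy mu (g * h)%g (lc a)).
    by move=> e1 e2 e3; lra.
  have := eE l; rewrite tnth_updt (negbTE lj) => /le_trans; apply.
  by rewrite ler_peMl// ler1n.
split; last by apply: main; left.
by move=> /(main (tnth phi i)^-1%g); rewrite mulKg; apply; right.
Qed.

End tuple.
End families.

(** * Eigenvalues and almost invariance *)

Section eigenvalues.
Variables (R : realType) (mu : probability (SU2 R) R).
Hypothesis haar : left_invariant mu.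
Variable n : nat.
Implicit Types (phi : n.-tuple (SU2 R)) (u k : SU2 R -> R).

Local Notation dim d := #|{: word d}|%N.
Local Notation gram := (gram mu).

Definition avg phi u x : R :=
  \sum_(i < n) (u ((tnth phi i)^-1 * x)%g + u (tnth phi i * x)%g).

Lemma sqint_avg phi u : sqint mu u -> sqint mu (avg phi u).
Proof. by move=> su; apply: sqint_sum => i; apply: sqintD; exact: sqint_translate. Qed.

Lemma ip_avg phi u k : sqint mu u -> sqint mu k -> ip mu (avg phi u) k = ip mu u (avg phi k).
Proof.
move=> su sk; rewrite [RHS]ipC.
have avgE f h : sqint mu f -> sqint mu h -> ip mu (avg phi f) h =
    \sum_(i < n) (ip mu (fun x => f ((tnth phi i)^-1 * x)%g) h +
                  ip mu (fun x => f (tnth phi i * x)%g) h).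
  move=> sf sh.
  have := @ip_suml _ mu _ (fun=> 1) (fun i x => f ((tnth phi i)^-1 * x)%g + f (tnth phi i * x)%g) h.
  under eq_fun do under eq_bigr do rewrite mul1r.
  move=> ->//; last by move=> i; apply: sqintD; exact: sqint_translate.
  by apply: eq_bigr => i _; rewrite mul1r ipDl//; exact: sqint_translate.
rewrite !avgE//; apply: eq_bigr => i _.
rewrite (ip_translate haar (tnth phi i)^-1%g su.1 sk.1) (ip_translate haar (tnth phi i) su.1 sk.1).
by rewrite invgK ![ip mu u _]ipC addrC.
Qed.

Lemma avg_lc phi d (a : 'rV[R]_(dim d)) x : avg phi (lc mu a) x = lc mu (a *m tau d phi) x.
Proof.
rewrite /tau mulmx_sumr /avg.
have lcD (b c : 'rV[R]_(dim d)) : lc mu (b + c) x = lc mu b x + lc mu c x.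
  by rewrite /lc -big_split; apply: eq_bigr => i _; rewrite mxE mulrDl.
rewrite (big_morph (fun b : 'rV_(dim d) => lc mu b x) lcD (id1 := 0)); last first.
  by rewrite /lc big1// => i _; rewrite mxE mul0r.
by apply: eq_bigr => i _; rewrite mulmxDr lcD !(lcM haar).
Qed.

Lemma lc_delta d (i : 'I_(dim d)) : lc mu (delta_mx 0 i) = fam mu i.
Proof.
apply/funext => x; rewrite /lc (bigD1 i)//= mxE !eqxx mul1r big1 ?addr0// => j ji.
by rewrite mxE (negbTE ji) andbF mul0r.
Qed.

(** Self-adjointness of [avg], expressed on coefficients. *)
Lemma tau_gram_sym phi d : (tau d phi *m gram d)^T = tau d phi *m gram d.
Proof.
have e (i j : 'I_(dim d)) : (tau d phi *m gram d) i j = ip mu (avg phi (fam mu i)) (fam mu j).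
  rewrite -!lc_delta (_ : avg _ _ = lc mu (delta_mx 0 i *m tau d phi)); last first.
    by apply/funext => x; exact: avg_lc.
  by rewrite ip_lc trmx_delta -colE [RHS]mxE -mulmxA -rowE [RHS]mxE.
apply/matrixP => i j; rewrite mxE !e ip_avg//; try exact: sqint_fam.
by rewrite ipC.
Qed.

Lemma gram_ker d (a : 'rV[R]_(dim d)) : a *m gram d = 0 -> lc mu a = cst 0 %[ae mu].
Proof.
move=> a0; apply: ip_eq0; first exact: sqint_lc.
by rewrite ip_lc a0 mul0mx mxE.
Qed.

Lemma ip_ae0 u k : measurable_fun setT u -> measurable_fun setT k ->
  u = cst 0 %[ae mu] -> ip mu u k = 0.
Proof.
move=> mu_ mk u0.
have m0 : measurable_fun [set: SU2 R] (cst (0 : R)) by exact: measurable_cst.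
rewrite (ip_ae_eq mu_ m0 mk u0).
by rewrite /ip; under eq_Rintegral do rewrite /= mul0r; rewrite /Rintegral integral0.
Qed.

Lemma ae_eq0_gram d (a : 'rV[R]_(dim d)) : lc mu a = cst 0 %[ae mu] -> a *m gram d = 0.
Proof.
move=> a0; apply/rowP => j; rewrite [RHS]mxE.
have := ip_ae0 (sqint_lc mu a).1 (sqint_fam mu j).1 a0.
by rewrite -[fam mu j]lc_delta ip_lc trmx_delta -colE mxE.
Qed.

(* [a] represents the orthogonal projection of [u] onto the finite-dimensional
   [avg]-stable space spanned by [fam]; it is again an eigenfunction. *)
Lemma eigen_polynomial phi u (t : R) : sqint mu u -> Rintegral mu setT u = 0 ->
  ~ (u = cst 0 %[ae mu]) -> avg phi u = (fun x => t * u x) %[ae mu] ->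
  exists d (a : 'rV[R]_(dim d)), 0 < ip mu (lc mu a) (lc mu a) /\
    total_energy mu phi (lc mu a) = ((2 * n)%:R - t) * ip mu (lc mu a) (lc mu a).
Proof.
move=> su u0 une ueig.
have [w uw] : exists w, ip mu u (mono w) <> 0.
  apply: contrapT => /forallNP h; apply: une.
  have := @moments0_ae_eq0 R mu u (sqint_integrable su) (fun w => contrapT (h w)).
  by apply: filterS => x /= /(_ Logic.I) [].
pose d := size w; pose w' : word d := [ffun i : 'I_(size w) => nth ord0 w i].
pose b : 'rV[R]_(dim d) := \row_i ip mu u (fam mu i).
have sfam (i : 'I_(dim d)) : sqint mu (fam mu i) by exact: sqint_fam.
(* Centering the monomial does not change its pairing with u, which has mean zero. *)
have b0 : b != 0.
  apply/eqP => /rowP/(_ (enum_rank w')); rewrite !mxE => h; apply: uw.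
  rewrite -h /fam enum_rankK [RHS]ipC ipBl//; last exact: sqint_polyfun (polyfun_cst _).
    rewrite mono_wordf ipC [X in _ - X](_ : _ = 0) ?subr0//.
    rewrite /ip RintegralZl//; last exact: sqint_integrable.
    by rewrite u0 mulr0.
  exact/sqint_polyfun/polyfun_wordf.
have ip_u (a : 'rV[R]_(dim d)) : ip mu u (lc mu a) = (b *m a^T) 0 0.
  rewrite ipC ip_suml// mxE; apply: eq_bigr => i _.
  by rewrite !mxE ipC mulrC.
have btau : b *m (tau d phi)^T = t *: b.
  apply/rowP => i.
  have -> : (b *m (tau d phi)^T) 0 i = ip mu u (avg phi (fam mu i)).
    rewrite -lc_delta (_ : avg _ _ = lc mu (delta_mx 0 i *m tau d phi)); last first.
      by apply/funext => x; exact: avg_lc.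
    by rewrite ip_u trmx_mul trmx_delta mulmxA -colE [RHS]mxE.
  rewrite -ip_avg// (ip_ae_eq (sqint_avg _ su).1 _ (sfam i).1 ueig); last first.
    exact: measurable_funM su.1.
  by rewrite ipZl// !mxE.
(* Kernel vectors of the Gram matrix represent null functions, so they annihilate b; hence b lies in
   the row space. *)
have /submxP[a ba] : (b <= gram d)%MS.
  rewrite submxE; apply/eqP/rowP => k; rewrite [RHS]mxE.
  have c0 : (col k (cokermx (gram d)))^T *m gram d = 0.
    by apply: trmx_inj; rewrite trmx_mul trmxK gram_sym trmx0 colE mulmxA mulmx_coker mul0mx.
  have := ip_ae0 (sqint_lc mu _).1 su.1 (gram_ker c0).
  by rewrite ipC ip_u trmxK colE mulmxA -colE mxE.
have q0 : ip mu (lc mu a) (lc mu a) <> 0.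
  move=> /(ip_eq0 (sqint_lc mu a)) /ae_eq0_gram; rewrite -ba.
  by apply/eqP.
exists d, a; split; first by rewrite lt_def ip_ge0 andbT; apply/eqP.
rewrite (total_energy_lc haar) ip_lc mulrBl; congr (_ - _).
rewrite -(mulmxA a (tau d phi)) (_ : tau d phi *m gram d = gram d *m (tau d phi)^T); last first.
  by rewrite -[LHS]tau_gram_sym trmx_mul gram_sym.
by rewrite !mulmxA -ba btau -scalemxAl mxE.
Qed.

(** By [total_energy_lc] the hypothesis at k is a Rayleigh quotient above 2n - 1/(k+1), hence yields
    an eigenvalue of the pencil above it. *)
Lemma almost_invariant_eigen phi (k : nat) : (0 < n)%N -> almost_invariant mu phi ->
  exists (t : R) d (a : 'rV[R]_(dim d)), [/\ (2 * n)%:R - k.+1%:R^-1 < t,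
    ~ (lc mu a = cst 0 %[ae mu]) & avg phi (lc mu a) = (fun x => t * lc mu a x) %[ae mu]].
Proof.
move=> n0 /(_ k)[d [a]].
rewrite (total_energy_lc haar) ip_lc => h.
have k0 : 0 < k.+1%:R :> R by rewrite ltr0n.
have [||||||e [w [ce wS wG]]] := @generalized_eigenvalue_real R _ (gram d)
  (tau d phi *m gram d) a ((2 * n)%:R - k.+1%:R^-1).
- exact: gram_sym.
- exact: tau_gram_sym.
- by move=> w; rewrite -ip_lc; exact: ip_ge0.
- by move=> w w0; rewrite -tau_gram_sym trmx_mul gram_sym mulmxA w0 mul0mx.
(* A positive n keeps the threshold nonnegative: 1/(k+1) <= 1 <= 2n. *)
- rewrite subr_ge0; apply: (@le_trans _ _ 1); first by rewrite invf_le1// ler1n.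
  by rewrite ler1n muln_gt0.
- move: h; rewrite mulmxA; set q := (_ *m gram d *m _) 0 0; set s := (_ *m _ *m _ *m _) 0 0 => h.
  have : k.+1%:R * (((2 * n)%:R - k.+1%:R^-1) * q) < k.+1%:R * s.
    rewrite mulrBl mulrBr mulrA mulrA divff ?gt_eqF// mul1r; lra.
  by rewrite ltr_pM2l.
exists e, d, w; split => //; first by move=> /ae_eq0_gram /eqP; rewrite (negbTE wG).
(* The eigenvalue equation holds only after multiplication by the Gram matrix, so the defect is a
   null function. *)
have : lc mu (w *m tau d phi - e *: w) = cst 0 %[ae mu].
  by apply: gram_ker; rewrite mulmxBl -scalemxAl -mulmxA wS subrr.
apply: filterS => x /= /(_ Logic.I) hx _; rewrite avg_lc.
apply/eqP; rewrite -subr_eq0 -[X in _ == X]hx; apply/eqP.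
rewrite /lc mulr_sumr -sumrB; apply: eq_bigr => i _.
by rewrite !mxE; ring.
Qed.

End eigenvalues.

(** * Comparison of lambda_1 with 2n *)

Section lambda1.
Variables (R : realType) (mu : probability (SU2 R) R).
Hypothesis haar : left_invariant mu.
Variable n : nat.
Implicit Types (phi : n.-tuple (SU2 R)) (u : SU2 R -> R) (f : SU2 R -> R[i]).

Lemma Lfun2P u : (u \in Lfun mu 2%:E) <-> sqint mu u.
Proof.
split.
  move=> uL; split; last exact: Lfun2_integrable_sqr.
  by move: uL; rewrite inE => /andP[]; rewrite inE.
move=> [mu_ iu]; rewrite inE; apply/andP; split; rewrite inE//=.
rewrite /finite_norm unlock poweR_lty//.
under eq_integral => x _ do rewrite /= powR_mulrn// -normrX.
by move/integrableP : iu => [].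
Qed.

Lemma avg_Re phi f x : complex.Re (sum_op phi f x) = avg phi (fun x => complex.Re (f x)) x.
Proof.
rewrite /sum_op /avg raddf_sum; apply: eq_bigr => i _.
by rewrite raddfD /= /ltranslate invgK.
Qed.

Lemma avg_Im phi f x : complex.Im (sum_op phi f x) = avg phi (fun x => complex.Im (f x)) x.
Proof.
rewrite /sum_op /avg raddf_sum; apply: eq_bigr => i _.
by rewrite raddfD /= /ltranslate invgK.
Qed.

(** For real t the operator acts separately on real and imaginary parts; whichever is not null
    serves as u. *)
Lemma is_eigenvalue_real phi (t : R) : is_eigenvalue mu phi t%:C ->
  exists u, [/\ sqint mu u, Rintegral mu setT u = 0, ~ (u = cst 0 %[ae mu]) &
    avg phi u = (fun x => t * u x) %[ae mu]].
Proof.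
move=> [f [[[/Lfun2P fR /Lfun2P fI] f0] fn0 feig]].
have [r0 i0] : Rintegral mu setT (fun x => complex.Re (f x)) = 0 /\
    Rintegral mu setT (fun x => complex.Im (f x)) = 0.
  (* Testing against the constant 1 gives both means at once. *)
  have := f0 1; rewrite /inner /cintegral.
  under eq_Rintegral do rewrite [cst 1 _]/(1 : R[i]) conjc1 mulr1.
  under [X in _ +i* X]eq_Rintegral do rewrite [cst 1 _]/(1 : R[i]) conjc1 mulr1.
  by case.
have [R0|Rn0] := pselect ((fun x => complex.Re (f x)) = cst 0 %[ae mu]).
  have [I0|In0] := pselect ((fun x => complex.Im (f x)) = cst 0 %[ae mu]).
    exfalso; apply: fn0; apply: filterS2 R0 I0 => x /= + + xT.
    by move=> /(_ xT) + /(_ xT); case: (f x) => a b /= -> ->.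
  exists (fun x => complex.Im (f x)); split => //.
  apply: filterS feig => x /= + xT => /(_ xT) e.
  by rewrite -avg_Im e; case: (f x) => a b /=; rewrite mul0r addr0.
exists (fun x => complex.Re (f x)); split => //.
apply: filterS feig => x /= + xT => /(_ xT) e.
by rewrite -avg_Re e; case: (f x) => a b /=; rewrite mul0r subr0.
Qed.

Lemma real_is_eigenvalue phi (t : R) u : sqint mu u -> Rintegral mu setT u = 0 ->
  ~ (u = cst 0 %[ae mu]) -> avg phi u = (fun x => t * u x) %[ae mu] ->
  is_eigenvalue mu phi t%:C.
Proof.
move=> su u0 un0 ueig; exists (fun x => (u x)%:C); split.
- split; first split.
  + exact/Lfun2P.
  + by apply/Lfun2P/sqint_polyfun; exact: polyfun_cst.
  move=> -[a b]; rewrite /inner /cintegral /=.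
  have iu := sqint_integrable su.
  under eq_Rintegral do rewrite mul0r subr0.
  under [X in _ +i* X]eq_Rintegral do rewrite mul0r addr0.
  by rewrite !RintegralZr// u0 !mul0r.
- move=> h; apply: un0; apply: filterS h => x /= + xT => /(_ xT).
  by case.
- apply: filterS ueig => x /= + xT => /(_ xT) e.
  apply/eqP; rewrite eq_complex avg_Re avg_Im /= e mul0r mulr0 subr0 mul0r addr0 eqxx /=.
  by apply/eqP; rewrite /avg big1// => i _; rewrite addr0.
Qed.

Lemma lambda1_le phi : (lambda1 mu phi <= (2 * n)%:R%:E)%E.
Proof.
apply: ge_ereal_sup => _ [t /is_eigenvalue_real[u [su u0 un0 ueig]] <-].
have [d [a [q0 e]]] := eigen_polynomial haar su u0 un0 ueig.
rewrite lee_fin -subr_ge0 -(pmulr_lge0 _ q0) -e.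
by apply: sumr_ge0 => i _; exact: ip_ge0.
Qed.

Lemma almost_invariant_lambda1 phi : (0 < n)%N -> almost_invariant mu phi ->
  lambda1 mu phi = (2 * n)%:R%:E.
Proof.
move=> n0 ai; apply/eqP; rewrite eq_le lambda1_le /=.
apply/lee_addgt0Pr => e e0.
have [k _ /(_ k (leqnn k)) ke] := near_infty_natSinv_lt (PosNum e0).
have [t [d [a [te an0 aeig]]]] := almost_invariant_eigen haar k n0 ai.
have a0 : Rintegral mu setT (lc mu a) = 0.
  rewrite (Rintegral_lincomb (fun i => a 0 i) (fun i => sqint_integrable (sqint_fam mu i))).
  by rewrite big1// => i _; rewrite fam_mean0 mulr0.
apply: (@le_trans _ _ (t%:E + e%:E)%E).
  by rewrite -EFinD lee_fin -lerBlDr ltW// (le_lt_trans _ te)// lerB// ltW.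
rewrite leeD2r//; apply: ereal_sup_ubound; exists t => //.
exact: real_is_eigenvalue (sqint_lc mu a) a0 an0 aeig.
Qed.

(** Failure at one k is a gap 1/(k+1) uniform over all polynomials, and [eigen_polynomial] realizes
    every eigenvalue on a polynomial. *)
Lemma lambda1_lt phi : ~ almost_invariant mu phi -> (lambda1 mu phi < (2 * n)%:R%:E)%E.
Proof.
move=> /existsNP[k kP].
have k0 : 0 < k.+1%:R :> R by rewrite ltr0n.
apply: (@le_lt_trans _ _ ((2 * n)%:R - k.+1%:R^-1)%:E); last first.
  by rewrite lte_fin ltrBlDr ltrDl invr_gt0.
apply: ge_ereal_sup => _ [t /is_eigenvalue_real[u [su u0 un0 ueig]] <-].
have [d [a [q0 e]]] := eigen_polynomial haar su u0 un0 ueig.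
rewrite lee_fin lerBrDr -lerBrDl.
have : ip mu (lc mu a) (lc mu a) <= k.+1%:R * total_energy mu phi (lc mu a).
  by rewrite leNgt; apply/negP => h; apply: kP; exists d, a.
by rewrite e mulrA ler_pMl// -ler_pdivrMl// mulr1.
Qed.

End lambda1.

(** * Zero-one law for almost invariance *)

Section generic_pairs.
Variables (R : realType) (mu : probability (SU2 R) R).
Hypothesis haar : left_invariant mu.
Variable n : nat.
Local Notation Q := (power_prob mu n).
Implicit Types (E : set (n.-tuple (SU2 R))) (i j k : 'I_n).

Lemma null_sections E j : measurable E ->
  {ae Q, forall x, mu [set y | E (updt j y x)] = 0%E} -> Q E = 0%E.
Proof.
move=> mE h; rewrite -(resample mu j mE) (ae_eq_integral (cst 0%E))//.
- by rewrite integral0.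
- pose E' := (fun p : SU2 R * n.-tuple (SU2 R) => updt j p.1 p.2) @^-1` E.
  have mE' : measurable E'.
    by rewrite -[X in measurable X]setTI; exact: measurable_updt.
  rewrite (_ : (fun x => _) = mu \o ysection E'); first exact: measurable_fun_ysection.
  by apply/funext => x /=; rewrite ysectionE.
- by apply: filterS h => x + _.
Qed.

(** Two successive section arguments: coordinate i is almost surely not torsion, and for such a
    value the bad values of coordinate k are null. *)
Lemma null_not_good_pair i k : i != k ->
  {ae Q, forall x, good (tnth x i) (tnth x k)}.
Proof.
move=> ik.
have mi (j : 'I_n) : measurable_fun [set: n.-tuple (SU2 R)] (fun x => tnth x j).
  exact: measurable_tnth.
pose E := [set x : n.-tuple (SU2 R) | ~ good (tnth x i) (tnth x k)].
have mE : measurable E.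
  rewrite (_ : E = (fun x => (tnth x i, tnth x k)) @^-1` ~` [set p | good p.1 p.2])//.
  have mp : measurable_fun setT (fun x : n.-tuple (SU2 R) => (tnth x i, tnth x k)).
    exact: measurable_fun_pair.
  by rewrite -[X in measurable X]setTI; apply: mp => //; apply: measurableC; exact: measurable_good.
apply/negligibleP; first exact: mE.
apply: (null_sections (j := k)) => //.
have tors : {ae Q, forall x, forall m, (tnth x i ^+ m.+1)%g <> 1%g}.
  apply/ae_foralln => m; pose F := [set x : n.-tuple (SU2 R) | (tnth x i ^+ m.+1)%g = 1%g].
  have mF : measurable F.
    by apply: measurable_eqg; [exact: measurable_expg|exact: measurable_cst].
  suff F0 : Q.-negligible F by apply: negligibleS F0 => x /= /contrapT.
  apply/negligibleP => //; apply: (null_sections (j := i)) => //.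
  apply: nearW => x; rewrite -[RHS](null_torsion haar m); congr (mu _).
  by apply/seteqP; split=> y /=; rewrite /F /= tnth_updt eqxx.
apply: filterS tors => x xtor; rewrite -[RHS](null_not_good haar xtor); congr (mu _).
by apply/seteqP; split=> y /=; rewrite /E /= !tnth_updt eqxx (negbTE ik).
Qed.

Lemma almost_invariant_01 : (3 <= n)%N ->
  Q (@almost_invariant R mu n) = 0%E \/
  Q (@almost_invariant R mu n) = 1%E.
Proof.
move=> n3; have mA := @measurable_almost_invariant R mu haar n.
apply: zero_one => // j.
have [i [k [ij kj ik]]] : exists i k : 'I_n, [/\ i != j, k != j & i != k].
  have : (1 < #|predC1 j|)%N by rewrite cardC1 card_ord; case: n n3 => [|[|[]]].
  case/card_gt1P => i [k [ij kj ik]]; exists i, k.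
  by move: ij kj; rewrite !inE.
apply: filterS (null_not_good_pair ik) => x xik.
apply: (invariant_set_01 haar _ xik); first exact: measurable_section.
- by move=> g; exact: almost_invariant_mul.
- by move=> g; exact: almost_invariant_mul.
Qed.

End generic_pairs.

Theorem theorem1p2 (R : realType) (mu : probability (SU2 R) R)
    (haar : left_invariant mu) (n : nat) (hn : (3 <= n)%N) :
  {ae power_prob mu n, forall phi : n.-tuple (SU2 R),
      (lambda1 mu phi < (2 * n)%:R%:E)%E} \/
  {ae power_prob mu n, forall phi : n.-tuple (SU2 R),
      lambda1 mu phi = (2 * n)%:R%:E}.
Proof.
have mA := @measurable_almost_invariant R mu haar n.
have [A0|A1] := almost_invariant_01 haar hn; [left|right].
- have N : (power_prob mu n).-negligible (@almost_invariant R mu n).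
    exact/negligibleP.
  by apply: negligibleS N => phi /= h; apply: contrapT => /(lambda1_lt haar).
- have N : (power_prob mu n).-negligible (~` (@almost_invariant R mu n)).
    apply/negligibleP; first exact: measurableC.
    transitivity (1 - power_prob mu n (@almost_invariant R mu n))%E.
      exact: probability_setC.
    by rewrite A1 subee.
  apply: negligibleS N => phi /= h /(almost_invariant_lambda1 haar) h'.
  by apply: h; apply: h'; exact: leq_trans hn.
Qed.
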